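(* Consider the problem $$\min_{x\in\mathbb{R}^{d_x}}\max_{y\in\mathbb{R}^{d_y}}\{f(x)+G(x,y)-h(y)\},\qquad G(x,y)=\frac1{m_G}\sum_{i=1}^{m_G}G_i(x,y),$$ with $m_G\ge1$, where $f$ is $\mu_x$-strongly convex and $L_f$-smooth, $h$ is $\mu_y$-strongly convex and $L_h$-smooth, each $G_i$ is convex in $x$, concave in $y$ and $L_G^i$-smooth jointly in $(x,y)$, and $L_G=\frac1{m_G}\sum_{i=1}^{m_G}L_G^i$. Assume additionally $\mu_x\le L_G$, $\mu_x\le L_f$ and $\mu_y\le L_G$. Then for any $\varepsilon>0$ there is a (deterministic first-order) algorithm that finds an $\varepsilon$-solution to this problem with the following numbers of basic oracle calls: $$\nabla f:\ \widetilde O\left(\sqrt{\frac{L_GL_f}{\mu_x\mu_y}}\right),\qquad\nabla h:\ \widetilde O\left(\max\left\{\sqrt{\frac{L_GL_h}{\mu_x\mu_y}},\sqrt{\frac{L_G^2}{\mu_x\mu_y}}\right\}\right),$$ $$\nabla_xG_i:\ \widetilde O\left(m_G\sqrt{\frac{L_G^2}{\mu_x\mu_y}}\right),\qquad\nabla_yG_i:\ \widetilde O\left(m_G\sqrt{\frac{L_G^2}{\mu_x\mu_y}}\right).$$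
   Context: Norms are Euclidean. A function is $L$-smooth if its gradient is $L$-Lipschitz; for $G_i$: $\|\nabla G_i(x_1,x_2)-\nabla G_i(y_1,y_2)\|\le L_G^i\|(x_1,x_2)-(y_1,y_2)\|$ on $\mathbb{R}^{d_x}\times\mathbb{R}^{d_y}$. A basic oracle call is one evaluation of $\nabla f(x)$, of $\nabla h(y)$, of one $\nabla_xG_i(x,y)$, or of one $\nabla_yG_i(x,y)$, respectively. $\widetilde O(X)$ hides constant factors and factors polylogarithmic in $\varepsilon^{-1}$. A point $\hat y$ is an $\varepsilon$-solution of the saddle-point problem if $h(\hat y)+\max_{x}\{-G(x,\hat y)-f(x)\}-\min_{y}\max_{x}\{h(y)-G(x,y)-f(x)\}\le\varepsilon$. *)

(* Defs.v *)
From mathcomp Require Import all_boot all_order all_algebra.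
From mathcomp Require Export all_classical all_reals all_analysis.
Export numFieldNormedType.Exports.

Set Implicit Arguments.
Unset Strict Implicit.
Unset Printing Implicit Defensive.

Import Order.TTheory GRing.Theory Num.Theory.
Local Open Scope classical_set_scope.
Local Open Scope ring_scope.

Section Euclidean.
Variables (R : realType) (n : nat).
Implicit Types (f : 'rV[R]_n -> R) (x : 'rV[R]_n).

(* The library norm on row vectors is the sup norm; it induces the same
   topology, hence the same derivatives, but not the same Lipschitz constants. *)
Definition enorm x : R := Num.sqrt (\sum_(j < n) x 0 j ^+ 2).

Definition grad f x : 'rV[R]_n := \row_(j < n) 'D_(delta_mx 0 j) f x.

(* [0 <= L] follows from the Lipschitz bound as soon as [0 < n]; it is there for
   the zero-dimensional space only. *)
Definition smooth (L : R) f : Prop :=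
  [/\ 0 <= L, (forall x, differentiable f x)
    & forall x y, enorm (grad f x - grad f y) <= L * enorm (x - y)].

Definition strongly_convex (mu : R) f : Prop :=
  forall (x y : 'rV[R]_n) (t : R), 0 <= t <= 1 ->
    f (t *: x + (1 - t) *: y) <=
      t * f x + (1 - t) * f y - mu / 2 * (t * (1 - t)) * enorm (x - y) ^+ 2.

Definition convex f : Prop := convex_function [set: 'rV[R]_n] f.

Definition concave f : Prop := convex (fun x => - f x).

End Euclidean.

Definition average (R : realType) (m : nat) (a : 'I_m -> R) : R :=
  m%:R^-1 * \sum_(i < m) a i.

Section SaddlePoint.
Variables (R : realType) (dx dy : nat).
Variables (f : 'rV[R]_dx -> R) (h : 'rV[R]_dy -> R).
Variable G : 'rV[R]_dx -> 'rV[R]_dy -> R.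

Definition is_max (A : set R) (v : R) : Prop := A v /\ ubound A v.
Definition is_min (A : set R) (v : R) : Prop := A v /\ lbound A v.

Definition eps_solution (eps : R) (yhat : 'rV[R]_dy) : Prop :=
  exists v w : R,
    [/\ is_max [set - G x yhat - f x | x in [set: 'rV[R]_dx]] v,
        is_min [set u | exists y,
                  is_max [set h y - G x y - f x | x in [set: 'rV[R]_dx]] u] w
      & h yhat + v - w <= eps].

Definition is_saddle_point (xs : 'rV[R]_dx) (ys : 'rV[R]_dy) : Prop :=
  forall x y,
    f xs + G xs y - h y <= f xs + G xs ys - h ys <= f x + G x ys - h ys.

End SaddlePoint.

Section OracleModel.
Variables (R : realType) (dx dy m : nat).

Inductive query : Type :=
| Query_f of 'rV[R]_dx
| Query_h of 'rV[R]_dy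
| Query_Gx of 'I_m & 'rV[R]_dx & 'rV[R]_dy
| Query_Gy of 'I_m & 'rV[R]_dx & 'rV[R]_dy.

Definition answer (q : query) : Type :=
  match q with
  | Query_f _ | Query_Gx _ _ _ => 'rV[R]_dx
  | Query_h _ | Query_Gy _ _ _ => 'rV[R]_dy
  end.

(* A deterministic method: each query, and finally the returned point, is a
   function of the answers received so far. The functions of the problem are
   accessible through the answers only; every run is finite because the tree is
   well-founded. *)
Inductive algorithm : Type :=
| Return of 'rV[R]_dy
| Ask (q : query) of (answer q -> algorithm).

Definition oracle := forall q : query, answer q.

Definition first_order_oracle (f : 'rV[R]_dx -> R) (h : 'rV[R]_dy -> R)
    (G : 'I_m -> 'rV[R]_dx -> 'rV[R]_dy -> R) : oracle :=
  fun q => match q return answer q with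
  | Query_f x => grad f x
  | Query_h y => grad h y
  | Query_Gx i x y => grad (fun x' => G i x' y) x
  | Query_Gy i x y => grad (fun y' => G i x y') y
  end.

Fixpoint output (O : oracle) (A : algorithm) : 'rV[R]_dy :=
  match A with
  | Return y => y
  | Ask q next => output O (next (O q))
  end.

Fixpoint calls (P : query -> bool) (O : oracle) (A : algorithm) : nat :=
  match A with
  | Return _ => 0%N
  | Ask q next => (P q + calls P O (next (O q)))%N
  end.

Definition is_f (q : query) := if q is Query_f _ then true else false.
Definition is_h (q : query) := if q is Query_h _ then true else false.
Definition is_Gx (q : query) := if q is Query_Gx _ _ _ then true else false.
Definition is_Gy (q : query) := if q is Query_Gy _ _ _ then true else false.

End OracleModel.

(* [N] is soft-O of [X]: [ln (2 + eps^-1) ^+ k] is the factor polylogarithmic in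
   [eps^-1], and [C * ln (2 + Q) ^+ k] is the hidden constant. [C] and [k] are to
   be absolute. [Q] is a scale of the instance (parameters and initial distance);
   no bound independent of it can hold, since for a fixed [eps] the number of
   calls grows with the initial distance. It is allowed inside a logarithm only:
   were the hidden constant an arbitrary function of the smoothness and strong
   convexity parameters, [X] would carry no information. *)
Definition soft_O (R : realType) (C : R) (k : nat) (Q eps X : R) (N : nat) : Prop :=
  N%:R <= C * ln (2 + Q) ^+ k * ln (2 + eps^-1) ^+ k * X.

(* Main.v *)
(* Every solver returns a point whose distance to the solution is at most [k^-1] times
   that of a fixed starting point, which makes nesting easy: an inner solver of
   accuracy a fixed power of [k] suffices for an outer one of accuracy [k], and only
   logarithms of [k] enter the counts.

   Two building blocks are nested. An inexact accelerated proximal point method in one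
   of the two variables, with regularization [H], adds the quadratic [H / 2 |. - z|^2]
   at the price of a factor [sqrt (H / mu)]. A forward-backward step with a monotone
   [L]-Lipschitz operator [A] and an [L]-strongly monotone operator [B] contracts by
   [1 / sqrt 2].

   Accelerating in [y] with [H = LG] costs [sqrt (LG / muy)]. If [LG <= Lf],
   accelerating in [x] with [H = LG] costs [sqrt (LG / mux)], and forward-backward steps
   on [G] then need only logarithmically many proximal steps on [f] and [h], costing
   [sqrt (Lf / LG)] and [max (sqrt (Lh / LG)) 1] gradients. If [Lf < LG], accelerating
   in [x] with [H = Lf] costs [sqrt (Lf / mux)]; forward-backward steps on [f] replace
   [f] by quadratics, and a further acceleration in [x], costing [sqrt (LG / Lf)],
   leads back to forward-backward steps on [G]. *)
Require Import Defs.
From mathcomp Require Import all_boot all_order all_algebra.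
From mathcomp Require Import all_classical all_reals all_analysis.
From mathcomp Require Import ring lra.
Import Order.TTheory GRing.Theory Num.Theory.
Set Implicit Arguments.
Unset Strict Implicit.
Unset Printing Implicit Defensive.
Local Open Scope ring_scope.

(** * Euclidean geometry *)

Section InnerProduct.
Variable R : realType.
Implicit Types (n : nat) (a b : R).

(** The obstacle is that loop lengths cannot be tuned to the functions: the algorithm is fixed
    before [f], [h] and [G], and one integer [l], computed from the first answers, sets all of them.
    So [k = 2 ^+ l] has to dominate the accuracy and every condition number at once; a loss
    polynomial in the conditioning is then a power of [k], paid by multiplying [l] by 2 or 7 one
    level deeper. The depth is bounded, hence the loops cost a fixed power of [l] times a product of
    square roots that telescopes to the claimed rates. The case distinction comes from [f]: a
    backward step on [f] takes at least one gradient of [f] per forward-backward step on [G]. For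
    [Lf < LG] this would add up to [sqrt (LG^2 / (mux muy))] gradients, above the allowed
    [sqrt (LG Lf / (mux muy))], so [f] must be handled in a layer outside the loop on [G].
    Everything is phrased through zeros of monotone operators, which exist by contraction; no
    minimax theorem is invoked, and the primal function is never differentiated. *)

Definition dot n (u v : 'rV[R]_n) : R := \sum_(j < n) u 0 j * v 0 j.
Definition nsq n (u : 'rV[R]_n) : R := dot u u.

Lemma dotC n (u v : 'rV[R]_n) : dot u v = dot v u.
Proof. by apply: eq_bigr => j _; rewrite mulrC. Qed.

Lemma dotDl n (u v w : 'rV[R]_n) : dot (u + v) w = dot u w + dot v w.
Proof. by rewrite -big_split; apply: eq_bigr => j _; rewrite mxE mulrDl. Qed.

Lemma dotZl n a (u w : 'rV[R]_n) : dot (a *: u) w = a * dot u w.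
Proof. by rewrite mulr_sumr; apply: eq_bigr => j _; rewrite mxE mulrA. Qed.

Lemma dotDr n (u v w : 'rV[R]_n) : dot w (u + v) = dot w u + dot w v.
Proof. by rewrite dotC dotDl !(dotC w). Qed.

Lemma dotZr n a (u w : 'rV[R]_n) : dot w (a *: u) = a * dot w u.
Proof. by rewrite dotC dotZl dotC. Qed.

Lemma dotNl n (u w : 'rV[R]_n) : dot (- u) w = - dot u w.
Proof. by rewrite -scaleN1r dotZl mulN1r. Qed.

Lemma dotNr n (u w : 'rV[R]_n) : dot w (- u) = - dot w u.
Proof. by rewrite dotC dotNl dotC. Qed.

Lemma dot0l n (w : 'rV[R]_n) : dot 0 w = 0.
Proof. by rewrite -(scale0r w) dotZl mul0r. Qed.

Lemma dot0r n (w : 'rV[R]_n) : dot w 0 = 0.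
Proof. by rewrite dotC dot0l. Qed.

Definition dotE := (dotDl, dotDr, dotNl, dotNr, dotZl, dotZr, dot0l, dot0r).

Lemma nsq_ge0 n (u : 'rV[R]_n) : 0 <= nsq u.
Proof. by apply: sumr_ge0 => j _; rewrite -expr2 sqr_ge0. Qed.

Lemma nsqN n (u : 'rV[R]_n) : nsq (- u) = nsq u.
Proof. by rewrite /nsq !dotE opprK. Qed.

Lemma nsqZ n a (u : 'rV[R]_n) : nsq (a *: u) = a ^+ 2 * nsq u.
Proof. by rewrite /nsq !dotE mulrA expr2. Qed.

Lemma nsq0 n : nsq (0 : 'rV[R]_n) = 0.
Proof. exact: dot0l. Qed.

Lemma nsq_eq0 n (u : 'rV[R]_n) : nsq u <= 0 -> u = 0.
Proof.
move=> u0; have /eqP := le_anti (introT andP (conj u0 (nsq_ge0 u))).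
rewrite psumr_eq0 => [/allP h|j _]; last by rewrite -expr2 sqr_ge0.
apply/rowP => j; have := h j (mem_index_enum j).
by rewrite mxE -expr2 sqrf_eq0 => /eqP.
Qed.

Lemma enormE n (u : 'rV[R]_n) : enorm u = Num.sqrt (nsq u).
Proof. by rewrite /enorm; congr Num.sqrt; apply: eq_bigr => j _; rewrite expr2. Qed.

Lemma enorm_sqr n (u : 'rV[R]_n) : enorm u ^+ 2 = nsq u.
Proof. by rewrite enormE sqr_sqrtr ?nsq_ge0. Qed.

Lemma enorm_ge0 n (u : 'rV[R]_n) : 0 <= enorm u.
Proof. by rewrite enormE sqrtr_ge0. Qed.

Lemma enormN n (u : 'rV[R]_n) : enorm (- u) = enorm u.
Proof. by rewrite !enormE nsqN. Qed.

Lemma enormB n (u v : 'rV[R]_n) : enorm (u - v) = enorm (v - u).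
Proof. by rewrite -enormN opprB. Qed.

Lemma enorm_le n (u : 'rV[R]_n) a : 0 <= a -> (enorm u <= a) = (nsq u <= a ^+ 2).
Proof. by move=> a0; rewrite -enorm_sqr ler_sqr // nnegrE enorm_ge0. Qed.

Lemma dot_Young n (u v : 'rV[R]_n) a : 0 < a ->
  - (a * nsq u + a^-1 * nsq v) <= 2 * dot u v <= a * nsq u + a^-1 * nsq v.
Proof.
move=> a0.
have P := nsq_ge0 (a *: u - v); have Q := nsq_ge0 (a *: u + v).
have E : a * a^-1 = 1 by rewrite mulfV ?gt_eqF.
have ai : 0 < a^-1 by rewrite invr_gt0.
move: P Q; rewrite /nsq !dotE (dotC v u) => P Q.
have {}P := mulr_ge0 (ltW ai) P; have {}Q := mulr_ge0 (ltW ai) Q.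
apply/andP; split.
  suff -> : - (a * dot u u + a^-1 * dot v v) =
    2 * dot u v - a^-1 * (a * (a * dot u u) + a * dot u v + (a * dot u v + dot v v)) by lra.
  by field; rewrite gt_eqF.
suff -> : a * dot u u + a^-1 * dot v v = 2 * dot u v +
  a^-1 * (a * (a * dot u u) + - (a * dot u v) + (- (a * dot u v) + - - dot v v)) by lra.
by field; rewrite gt_eqF.
Qed.

Lemma nsqD_le n (u v : 'rV[R]_n) : nsq (u + v) <= 2 * nsq u + 2 * nsq v.
Proof.
have /andP[_] := dot_Young u v ltr01.
by rewrite invr1 /nsq !dotE (dotC v u); lra.
Qed.

Lemma Cauchy_Schwarz n (u v : 'rV[R]_n) : dot u v <= enorm u * enorm v.
Proof.
have [u0|u0] := eqVneq (enorm u) 0.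
  suff -> : u = 0 by rewrite dot0l mulr_ge0 ?enorm_ge0.
  by apply: nsq_eq0; rewrite -enorm_sqr u0 expr0n.
have [v0|v0] := eqVneq (enorm v) 0.
  suff -> : v = 0 by rewrite dot0r mulr_ge0 ?enorm_ge0.
  by apply: nsq_eq0; rewrite -enorm_sqr v0 expr0n.
have up : 0 < enorm u by rewrite lt0r u0 enorm_ge0.
have vp : 0 < enorm v by rewrite lt0r v0 enorm_ge0.
have /andP[_] := dot_Young u v (divr_gt0 vp up).
rewrite -!enorm_sqr.
suff -> : enorm v / enorm u * enorm u ^+ 2 + (enorm v / enorm u)^-1 * enorm v ^+ 2 =
  2 * (enorm u * enorm v) by lra.
by field; rewrite u0 v0.
Qed.

Lemma enormD n (u v : 'rV[R]_n) : enorm (u + v) <= enorm u + enorm v.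
Proof.
rewrite enorm_le ?addr_ge0 ?enorm_ge0 // /nsq !dotE (dotC v u).
have := Cauchy_Schwarz u v; rewrite sqrrD !enorm_sqr /nsq mulr2n; lra.
Qed.

Lemma enorm_dist n (u v w : 'rV[R]_n) : enorm (u - w) <= enorm (u - v) + enorm (v - w).
Proof. by rewrite (le_trans _ (enormD _ _)) // addrA subrK. Qed.

Lemma enormZ n a (u : 'rV[R]_n) : enorm (a *: u) = `|a| * enorm u.
Proof. by rewrite !enormE nsqZ sqrtrM ?sqr_ge0 // sqrtr_sqr. Qed.

Lemma enorm0 n : enorm (0 : 'rV[R]_n) = 0.
Proof. by rewrite enormE nsq0 sqrtr0. Qed.

Lemma enorm_sum n m (P : 'I_m -> 'rV[R]_n) :
  enorm (\sum_(i < m) P i) <= \sum_(i < m) enorm (P i).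
Proof.
elim/big_ind2: _ => [|u a v b ua vb|//]; first by rewrite enorm0.
by rewrite (le_trans (enormD _ _)) // lerD.
Qed.

Lemma dot_row n1 n2 (x x' : 'rV[R]_n1) (y y' : 'rV[R]_n2) :
  dot (row_mx x y) (row_mx x' y') = dot x x' + dot y y'.
Proof.
rewrite /dot big_split_ord; congr (_ + _); apply: eq_bigr => j _.
  by rewrite !row_mxEl.
by rewrite !row_mxEr.
Qed.

Lemma nsq_row n1 n2 (x : 'rV[R]_n1) (y : 'rV[R]_n2) :
  nsq (row_mx x y) = nsq x + nsq y.
Proof. exact: dot_row. Qed.

Lemma dot_submx n1 n2 (w w' : 'rV[R]_(n1 + n2)) :
  dot w w' = dot (lsubmx w) (lsubmx w') + dot (rsubmx w) (rsubmx w').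
Proof. by rewrite -dot_row !hsubmxK. Qed.

Lemma nsq_submx n1 n2 (w : 'rV[R]_(n1 + n2)) :
  nsq w = nsq (lsubmx w) + nsq (rsubmx w).
Proof. exact: dot_submx. Qed.

Lemma nsq_lsub_le n1 n2 (w : 'rV[R]_(n1 + n2)) : nsq (lsubmx w) <= nsq w.
Proof. by rewrite nsq_submx lerDl nsq_ge0. Qed.

Lemma nsq_rsub_le n1 n2 (w : 'rV[R]_(n1 + n2)) : nsq (rsubmx w) <= nsq w.
Proof. by rewrite nsq_submx lerDr nsq_ge0. Qed.

End InnerProduct.

(** * Strongly monotone Lipschitz operators *)

Section MonotoneOperators.
Variable R : realType.
Implicit Types (n : nat) (L mu : R).

Definition lip n L (T : 'rV[R]_n -> 'rV[R]_n) : Prop :=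
  forall u v, enorm (T u - T v) <= L * enorm (u - v).

Definition smono n mu (T : 'rV[R]_n -> 'rV[R]_n) : Prop :=
  forall u v, mu * nsq (u - v) <= dot (T u - T v) (u - v).

Lemma lip_nsq n L (T : 'rV[R]_n -> 'rV[R]_n) u v :
  lip L T -> nsq (T u - T v) <= L ^+ 2 * nsq (u - v).
Proof.
move=> /(_ u v) h; rewrite -!enorm_sqr -exprMn ler_sqr // nnegrE ?enorm_ge0 //.
exact: le_trans (enorm_ge0 _) h.
Qed.

Lemma lipW n L L' (T : 'rV[R]_n -> 'rV[R]_n) : L <= L' -> lip L T -> lip L' T.
Proof. by move=> LL h u v; rewrite (le_trans (h u v)) // ler_wpM2r ?enorm_ge0. Qed.

Lemma lipD n L L' (T T' : 'rV[R]_n -> 'rV[R]_n) :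
  lip L T -> lip L' T' -> lip (L + L') (fun w => T w + T' w).
Proof.
move=> h h' u v; rewrite opprD addrACA.
by rewrite mulrDl (le_trans (enormD _ _)) // lerD.
Qed.

Lemma smonoW n mu mu' (T : 'rV[R]_n -> 'rV[R]_n) : mu' <= mu -> smono mu T -> smono mu' T.
Proof. by move=> LL h u v; rewrite (le_trans _ (h u v)) // ler_wpM2r ?nsq_ge0. Qed.

Lemma smono_inj n mu (T : 'rV[R]_n -> 'rV[R]_n) u v :
  0 < mu -> smono mu T -> T u = T v -> u = v.
Proof.
move=> mu0 /(_ u v) h E; move: h; rewrite E subrr dot0l pmulr_rle0 // => /nsq_eq0.
by move/eqP; rewrite subr_eq0 => /eqP.
Qed.

Lemma geometric_cvg (a : nat -> R) (c q : R) : 0 <= q < 1 ->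
  (forall k, `|a k.+1 - a k| <= c * q ^+ k) -> cvgn a.
Proof.
move=> /andP[q0 q1] h.
have -> : a = (fun k => a 0%N + series (telescope a) k).
  by apply/funext => k; rewrite -eq_sum_telescope.
apply: is_cvgD; first exact: is_cvg_cst.
apply: normed_cvg.
apply: (@series_le_cvg _ _ (geometric c q)) => [k|k|k|].
- exact: normr_ge0.
- exact: le_trans (normr_ge0 _) (h k).
- exact: h.
by apply: is_cvg_geometric_series; rewrite ger0_norm.
Qed.

Lemma cvg_sum0 (I : Type) (r : seq I) (f : I -> nat -> R) :
  (forall i, f i k @[k --> \oo] --> (0 : R))%classic ->
  (\sum_(i <- r) f i k @[k --> \oo] --> (0 : R))%classic.
Proof.
move=> h; elim: r => [|i r IH].
  by under eq_fun do rewrite big_nil; exact: cvg_cst.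
under eq_fun do rewrite big_cons.
have H := cvgD (h i) IH; rewrite addr0 in H; exact: H.
Qed.

(** Iterating [u - eta T u] with [eta = mu / M^2] contracts squared distances by [1 - mu^2 / M^2].
    The coordinates converge geometrically, and [T] at the iterates is [- eta^-1] times the
    increments, which tend to 0. Saddle points, inner solutions and maximizers all come from
    here. *)
Lemma exist_zero n mu L (T : 'rV[R]_n -> 'rV[R]_n) :
  0 < mu -> smono mu T -> lip L T -> exists w, T w = 0.
Proof.
move=> mu0 Tm Tl.
(* The sign of [L] is unknown; the enlarged constant is positive and at least [mu]. *)
pose M := `|L| + mu.
have {}Tl : lip M T by apply: lipW Tl; rewrite /M; have := ler_norm L; lra.
have muM : mu <= M by rewrite /M lerDr normr_ge0.
have M0 : 0 < M by exact: lt_le_trans muM.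
have Mi : 0 < (M ^+ 2)^-1 by rewrite invr_gt0 exprn_gt0.
pose eta := mu / M ^+ 2.
have eta0 : 0 < eta by rewrite mulr_gt0.
pose rho := 1 - mu ^+ 2 / M ^+ 2.
have rho0 : 0 <= rho.
  by rewrite subr_ge0 ler_pdivrMr ?exprn_gt0 // mul1r ler_sqr // nnegrE ltW.
have rho1 : rho < 1 by rewrite gtrBl divr_gt0 ?exprn_gt0.
pose S u := u - eta *: T u.
have contr u v : nsq (S u - S v) <= rho * nsq (u - v).
  have -> : S u - S v = (u - v) - eta *: (T u - T v).
    by apply/rowP => j; rewrite !mxE; ring.
  have l := lip_nsq u v Tl; have s := Tm u v.
  have E : rho = 1 - eta * mu.
    by rewrite /rho /eta; congr (1 - _); field; rewrite gt_eqF.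
  have E2 : eta * (eta * (M ^+ 2 * nsq (u - v))) = eta * (mu * nsq (u - v)).
    by rewrite /eta; field; rewrite gt_eqF.
  have l1 : eta * (eta * nsq (T u - T v)) <= eta * (mu * nsq (u - v)).
    by rewrite -E2 !ler_pM2l.
  have s1 : eta * (mu * nsq (u - v)) <= eta * dot (T u - T v) (u - v).
    by rewrite ler_pM2l.
  rewrite E mulrBl mul1r -mulrA; move: l1 s1; move: (u - v) (T u - T v) => x y.
  rewrite /nsq !dotE (dotC x y); lra.
pose u k := iter k S 0.
pose d k := u k.+1 - u k.
have dk k : nsq (d k) <= nsq (d 0%N) * rho ^+ k.
  elim: k => [|k IH]; first by rewrite expr0 mulr1.
  by rewrite (le_trans (contr _ _)) // exprS mulrCA ler_wpM2l.
pose q := Num.sqrt rho.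
have q01 : 0 <= q < 1 by rewrite sqrtr_ge0 -sqrtr1 ltr_sqrt.
have coord j k : `|u k.+1 0 j - u k 0 j| <= Num.sqrt (nsq (d 0%N)) * q ^+ k.
  have qk : 0 <= Num.sqrt (nsq (d 0%N)) * q ^+ k by rewrite mulr_ge0 ?exprn_ge0 ?sqrtr_ge0.
  rewrite -ler_sqr ?nnegrE ?normr_ge0 // real_normK ?num_real // exprMn.
  rewrite sqr_sqrtr ?nsq_ge0 // -exprM mulnC exprM sqr_sqrtr //.
  apply: le_trans (dk k); rewrite /nsq /dot (bigD1 j) //= !mxE -expr2 lerDl.
  by apply: sumr_ge0 => i _; rewrite -expr2 sqr_ge0.
have ucv j : cvgn (fun k => u k 0 j) by exact: geometric_cvg q01 (coord j).
pose l : 'rV[R]_n := \row_j limn (fun k => u k 0 j).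
exists l; apply: nsq_eq0.
have bnd k : nsq (T l) <= 2 * (eta ^- 2 * (nsq (d 0%N) * rho ^+ k)) + 2 * (M ^+ 2 * nsq (l - u k)).
  have -> : T l = T (u k) + (T l - T (u k)) by rewrite addrC subrK.
  apply: le_trans (nsqD_le _ _) _; apply: lerD; rewrite ler_pM2l //; last first.
    exact: lip_nsq.
  suff -> : T (u k) = - (eta^-1 *: d k).
    by rewrite nsqN nsqZ exprVn ler_pM2l ?dk // invr_gt0 exprn_gt0.
  rewrite /d /u /= /S -/(u k) addrC addKr scalerN opprK scalerA mulVf ?scale1r //.
  by rewrite gt_eqF.
have rc : (rho ^+ k @[k --> \oo] --> (0 : R))%classic.
  by apply: cvg_expr; rewrite ger0_norm.
have lc : (nsq (l - u k) @[k --> \oo] --> (0 : R))%classic.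
  apply: cvg_sum0 => j.
  have h : ((l - u k) 0 j @[k --> \oo] --> l 0 j - l 0 j)%classic.
    under eq_fun do rewrite !mxE.
    by rewrite mxE; apply: cvgB; [exact: cvg_cst | exact: ucv].
  have H := cvgM h h; rewrite subrr mulr0 in H; exact: H.
have B : (2 * (eta ^- 2 * (nsq (d 0%N) * rho ^+ k)) + 2 * (M ^+ 2 * nsq (l - u k))
    @[k --> \oo] --> 2 * (eta ^- 2 * (nsq (d 0%N) * 0)) + 2 * (M ^+ 2 * 0))%classic.
  by apply: cvgD; do ?apply: cvgMl_tmp.
rewrite !mulr0 addr0 in B.
apply: (cvgr_to_ge B).
by apply: nearW => k; exact: bnd.
Qed.

End MonotoneOperators.

(** * Relative accuracy and forward-backward splitting *)

Section Solvers.
Variable R : realType.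
Implicit Types (n l : nat) (k L mu : R).

Definition solves n k (w0 : 'rV[R]_n) (T : 'rV[R]_n -> 'rV[R]_n) (w : 'rV[R]_n) :=
  forall ws, T ws = 0 -> enorm (w - ws) <= k^-1 * enorm (w0 - ws).

Lemma solves_ext n k (w0 : 'rV[R]_n) T T' w :
  T =1 T' -> solves k w0 T w -> solves k w0 T' w.
Proof. by move=> E h ws; rewrite -E; exact: h. Qed.

Lemma solves_exact n k mu (w0 : 'rV[R]_n) T w :
  0 < mu -> 0 < k -> smono mu T -> T w = 0 -> solves k w0 T w.
Proof.
move=> mu0 k0 Tm Tw ws Tws; rewrite (smono_inj mu0 Tm (etrans Tws (esym Tw))).
by rewrite subrr enorm0 mulr_ge0 ?enorm_ge0 // invr_ge0 ltW.
Qed.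

Lemma lip_affine n L (c : 'rV[R]_n) : 0 <= L -> lip L (fun p => L *: p + c).
Proof. by move=> L0 u v; rewrite opprD addrACA subrr addr0 -scalerBr enormZ ger0_norm. Qed.

Lemma smonoD n mu mu' (T T' : 'rV[R]_n -> 'rV[R]_n) :
  smono mu T -> smono mu' T' -> smono (mu + mu') (fun w => T w + T' w).
Proof. by move=> h h' u v; rewrite opprD addrACA dotDl mulrDl lerD. Qed.

Lemma smono_affine n L (c : 'rV[R]_n) : smono L (fun p => L *: p + c).
Proof. by move=> u v; rewrite opprD addrACA subrr addr0 -scalerBr dotZl. Qed.

Section ForwardBackward.
Variables (n : nat) (L LB : R) (A B : 'rV[R]_n -> 'rV[R]_n).
Hypotheses (L0 : 0 < L) (Am : smono 0 A) (Al : lip L A) (Bm : smono L B) (Bl : lip LB B).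

Let resolvent w := fun p => L *: (p - w) + A w + B p.

Lemma exist_resolvent w : exists p, resolvent w p = 0.
Proof.
have E : resolvent w =1 fun p => (L *: p + (A w - L *: w)) + B p.
  by move=> p; rewrite /resolvent scalerBr -!addrA; congr (_ + _); rewrite addrCA.
have [p pE] := exist_zero (addr_gt0 L0 L0)
  (smonoD (smono_affine L (A w - L *: w)) Bm) (lipD (lip_affine (A w - L *: w) (ltW L0)) Bl).
by exists p; rewrite E.
Qed.

(* The factor is [sqrt 2] for the forward step and [1/2] for the backward step. *)
Lemma resolvent_contraction w p ws : resolvent w p = 0 -> A ws + B ws = 0 ->
  enorm (p - ws) <= 3 / 4 * enorm (w - ws).
Proof.
move=> pE wsE.
have BE : B p - B ws = L *: (w - ws) - L *: (p - ws) - (A w - A ws).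
  move/eqP: wsE; rewrite addrC addr_eq0 => /eqP ->; move/eqP: pE.
  rewrite /resolvent addrC addr_eq0 => /eqP ->.
  by apply/rowP => j; rewrite !mxE; ring.
have := Bm p ws; have := Am w ws; have := lip_nsq w ws Al; rewrite BE.
move: (p - ws) (w - ws) (A w - A ws) => a b e e2 eb La.
have L20 : 0 < (2 * L)^-1 by rewrite invr_gt0 mulr_gt0.
have /andP[_ Y] := dot_Young (L *: b - e) a L20.
have h : nsq (L *: b - e) <= 2 * L ^+ 2 * nsq b.
  have : 0 <= L * dot e b by rewrite mul0r in eb; apply: mulr_ge0 => //; exact: ltW.
  by move: e2; rewrite /nsq !dotE (dotC b e) expr2; lra.
rewrite enorm_le ?mulr_ge0 ?enorm_ge0 // exprMn enorm_sqr.
suff : L * (2 * nsq a) <= L * nsq b by rewrite ler_pM2l //; have := nsq_ge0 b; lra.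
have h2 : (2 * L)^-1 * nsq (L *: b - e) <= L * nsq b.
  rewrite mulrC ler_pdivrMr ?mulr_gt0 //; move: h; rewrite expr2; lra.
move: La Y h2; rewrite invrK /nsq !dotE; lra.
Qed.

(** An exact step contracts by [3 / 4] and an inexact one adds at most [2 * th * d0] with
    [th = k ^- 2]. Since [2 / (1 - 3 / 4) = 8], the accumulated error stays below [8 * th * d0]. *)
Lemma forward_backward l (w0 : 'rV[R]_n) (step : 'rV[R]_n -> 'rV[R]_n) :
  let k := 2 ^+ l : R in 16 <= k ->
  (forall w, solves (2 ^+ (2 * l)) w0 (resolvent w) (step w)) ->
  solves k w0 (fun w => A w + B w) (iter (6 * l) step w0).
Proof.
rewrite [(2 * l)%N]mulnC exprM => k k16 h ws wsE; set d0 := enorm (w0 - ws).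
have d00 : 0 <= d0 by exact: enorm_ge0.
set th := (k ^+ 2)^-1.
have k0 : 0 < k by lra.
have th0 : 0 < th by rewrite invr_gt0 exprn_gt0.
have ki : k^-1 <= 16^-1 by rewrite lef_pV2 ?posrE.
have kth : 16 * th <= k^-1.
  rewrite /th expr2 invfM mulrA ler_piMl ?invr_ge0 ?(ltW k0) //.
  by rewrite ler_pdivrMr // mul1r.
(* The first half keeps the iterates in the initial ball, hence the exact steps [p] within [2 * d0]
   of [w0], the point relative to which [step] is accurate. *)
have inv j : enorm (iter j step w0 - ws) <= d0 /\
    enorm (iter j step w0 - ws) <= ((3 / 4) ^+ j + 8 * th) * d0.
  elim: j => [|j [IH1 IH2]].
    by split => //=; rewrite expr0 mulrDl mul1r lerDl mulr_ge0 // ltW // mulr_gt0.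
  rewrite iterS; set w := iter j step w0 in IH1 IH2 *.
  have [p pE] := exist_resolvent w.
  have pc := resolvent_contraction pE wsE.
  have hs := h w p pE; rewrite -/th in hs.
  have t1 : enorm (w0 - p) <= d0 + enorm (p - ws).
    by rewrite (enormB p); exact: enorm_dist.
  have t2 : th * enorm (w0 - p) <= th * (2 * d0) by rewrite ler_pM2l //; lra.
  have t3 := enorm_dist (step w) p ws.
  have t4 : th * (16 * d0) <= d0 by rewrite mulrA ler_piMl //; lra.
  split; first lra.
  rewrite exprS; set q := (3 / 4) ^+ j in IH2 *; lra.
have [_ /le_trans-> //] := inv (6 * l)%N.
apply: ler_wpM2r => //.
(* Six iterations per unit of [l] suffice because [(3 / 4) ^+ 6 <= 2 ^- 2]. *)
suff : (3 / 4 : R) ^+ (6 * l) <= th by lra.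
have -> : th = (2^-1 ^+ 2) ^+ l by rewrite /th /k -exprM mulnC exprM exprVn exprVn.
rewrite exprM; apply: lerXn2r; rewrite ?nnegrE; lra.
Qed.

End ForwardBackward.
End Solvers.

(** * Saddle operators and acceleration *)

Section SaddleOperators.
Variable R : realType.
Implicit Types (n l : nat) (k L mu c a : R).

(* [T] stands for the saddle operator [(grad_x K, - grad_y K)] of a function [K]
   that is [mu1]-strongly convex in [x] and [mu2]-strongly concave in [y]. *)
Definition saddle_op n1 n2 mu1 mu2 L (K : 'rV[R]_n1 -> 'rV[R]_n2 -> R)
    (T : 'rV[R]_(n1 + n2) -> 'rV[R]_(n1 + n2)) : Prop :=
  [/\ forall x x' y, K x y + dot (lsubmx (T (row_mx x y))) (x' - x)
        + mu1 / 2 * nsq (x' - x) <= K x' y,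
      forall x y y', K x y' <= K x y - dot (rsubmx (T (row_mx x y))) (y' - y)
        - mu2 / 2 * nsq (y' - y)
    & lip L T].

Lemma saddle_op_ext n1 n2 mu1 mu2 L (K : 'rV[R]_n1 -> 'rV[R]_n2 -> R) T T' :
  T =1 T' -> saddle_op mu1 mu2 L K T -> saddle_op mu1 mu2 L K T'.
Proof. by move=> /funext ->. Qed.

Lemma saddle_opD n1 n2 mu1 mu2 L mu1' mu2' L' (K K' : 'rV[R]_n1 -> 'rV[R]_n2 -> R) T T' :
  saddle_op mu1 mu2 L K T -> saddle_op mu1' mu2' L' K' T' ->
  saddle_op (mu1 + mu1') (mu2 + mu2') (L + L') (fun x y => K x y + K' x y)
    (fun w => T w + T' w).
Proof.
move=> [Kx Ky Tl] [Kx' Ky' Tl']; split; last exact: lipD.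
- by move=> x x' y; have := Kx x x' y; have := Kx' x x' y; rewrite raddfD dotDl; lra.
- by move=> x y y'; have := Ky x y y'; have := Ky' x y y'; rewrite raddfD dotDl; lra.
Qed.

Lemma saddle_op_quadr n1 n2 a (z : 'rV[R]_n2) : 0 <= a ->
  saddle_op 0 a a (fun (x : 'rV[R]_n1) y => - (a / 2 * nsq (y - z)))
    (fun w => row_mx 0 (a *: (rsubmx w - z))).
Proof.
move=> a0; split.
- by move=> x x' y; rewrite row_mxKl dot0l; lra.
- move=> x y y'; rewrite !row_mxKr dotZl.
  have -> : y' - z = (y' - y) + (y - z) by rewrite addrA subrK.
  by move: (y' - y) (y - z) => u v; rewrite /nsq !dotE (dotC v u); lra.
- move=> u v; rewrite enorm_le ?mulr_ge0 ?enorm_ge0 // exprMn enorm_sqr.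
  rewrite opp_row_mx add_row_mx nsq_row subr0 nsq0 add0r -scalerBr opprB addrA.
  rewrite subrK nsqZ; apply: ler_wpM2l; first exact: sqr_ge0.
  by rewrite -raddfB nsq_rsub_le.
Qed.

(** The convexity and concavity inequalities are added around the rectangle with opposite corners
    [(x, y)] and [(x', y')]; the values of [K] at the four corners cancel. *)
Lemma saddle_smono2 n1 n2 mu1 mu2 L (K : 'rV[R]_n1 -> 'rV[R]_n2 -> R) T w w' :
  saddle_op mu1 mu2 L K T ->
  mu1 * nsq (lsubmx (w - w')) + mu2 * nsq (rsubmx (w - w')) <= dot (T w - T w') (w - w').
Proof.
move=> [Kx Ky _]; rewrite dot_submx.
rewrite !raddfB /= -(hsubmxK w) -(hsubmxK w') !row_mxKl !row_mxKr.
move: (lsubmx w) (rsubmx w) (lsubmx w') (rsubmx w') => x y x' y'.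
have := Kx x x' y; have := Kx x' x y'; have := Ky x y y'; have := Ky x' y' y.
rewrite -(opprB x x') -(opprB y y') !nsqN !dotNr !dotDl !dotNl.
by move: (x - x') (y - y') => u v; lra.
Qed.

Lemma saddle_smono n1 n2 mu1 mu2 L c (K : 'rV[R]_n1 -> 'rV[R]_n2 -> R) T :
  c <= mu1 -> c <= mu2 -> saddle_op mu1 mu2 L K T -> smono c T.
Proof.
move=> c1 c2 KT w w'; apply: le_trans (saddle_smono2 w w' KT).
by rewrite nsq_submx mulrDr lerD // ler_wpM2r ?nsq_ge0.
Qed.

Definition swap n1 n2 (w : 'rV[R]_(n1 + n2)) : 'rV[R]_(n2 + n1) :=
  row_mx (rsubmx w) (lsubmx w).

Lemma swapK n1 n2 (w : 'rV[R]_(n1 + n2)) : swap (swap w) = w.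
Proof. by rewrite /swap row_mxKl row_mxKr hsubmxK. Qed.

Lemma swapB n1 n2 (w w' : 'rV[R]_(n1 + n2)) : swap (w - w') = swap w - swap w'.
Proof. by rewrite /swap !raddfB /= opp_row_mx add_row_mx. Qed.

Lemma nsq_swap n1 n2 (w : 'rV[R]_(n1 + n2)) : nsq (swap w) = nsq w.
Proof. by rewrite nsq_row addrC -nsq_submx. Qed.

Lemma enorm_swap n1 n2 (w : 'rV[R]_(n1 + n2)) : enorm (swap w) = enorm w.
Proof. by rewrite !enormE nsq_swap. Qed.

Lemma swap0 n1 n2 : swap (0 : 'rV[R]_(n1 + n2)) = 0.
Proof. by rewrite /swap !raddf0 row_mx0. Qed.

(** Exchanging the players turns [K] into [- K], so the signs in the operator persist and only its
    blocks are permuted. Acceleration in [x] thus reduces to acceleration in [y]. *)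
Lemma saddle_op_swap n1 n2 mu1 mu2 L (K : 'rV[R]_n1 -> 'rV[R]_n2 -> R) T :
  saddle_op mu1 mu2 L K T ->
  saddle_op mu2 mu1 L (fun y x => - K x y) (fun w => swap (T (swap w))).
Proof.
move=> [Kx Ky Tl]; split.
- by move=> y y' x; rewrite /swap !row_mxKl !row_mxKr; have := Ky x y y'; lra.
- by move=> y x x'; rewrite /swap !row_mxKl !row_mxKr; have := Kx x x' y; lra.
- by move=> u v; rewrite -swapB enorm_swap -(enorm_swap (u - v)) swapB.
Qed.

Lemma solves_swap n1 n2 k (w0 : 'rV[R]_(n1 + n2)) T w :
  solves k (swap w0) (fun v => swap (T (swap v))) w -> solves k w0 T (swap w).
Proof.
move=> h ws wsE; have := h (swap ws); rewrite swapK wsE swap0 => /(_ erefl).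
by rewrite -(enorm_swap (w - _)) -(enorm_swap (_ - swap ws)) !swapB !swapK.
Qed.

(** For fixed [y] the first block of [T] is a strongly monotone Lipschitz operator in [x]; its zero
    is the maximizer of [- K x y]. *)
Lemma saddle_primal n1 n2 mu1 mu2 L (K : 'rV[R]_n1 -> 'rV[R]_n2 -> R) T :
  0 < mu1 -> saddle_op mu1 mu2 L K T ->
  exists F : 'rV[R]_n2 -> R, forall y, (forall x, - K x y <= F y) /\ exists x, F y = - K x y.
Proof.
move=> m1 [Kx Ky Tl].
suff : forall y, exists v, (forall x, - K x y <= v) /\ exists x, v = - K x y by move/boolp.choice => [F FE]; exists F.
move=> y.
have Sm : smono mu1 (fun x => lsubmx (T (row_mx x y))).
  move=> x x'; have := Kx x x' y; have := Kx x' x y.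
  rewrite -(opprB x x') !nsqN !dotNr !dotDl !dotNl.
  by move: (x - x') => u; lra.
have Sl : lip L (fun x => lsubmx (T (row_mx x y))).
  move=> x x'; apply: le_trans (le_trans (Tl (row_mx x y) (row_mx x' y)) _).
    by rewrite -raddfB !enormE ler_wsqrtr // nsq_lsub_le.
  by rewrite opp_row_mx add_row_mx subrr !enormE nsq_row nsq0 addr0.
have [x xE] := exist_zero m1 Sm Sl.
exists (- K x y); split; last by exists x.
move=> x'; rewrite lerN2; apply: le_trans (Kx x x' y); rewrite xE dot0l addr0 lerDl.
by rewrite mulr_ge0 ?nsq_ge0 // divr_ge0 // ltW.
Qed.

End SaddleOperators.

(** * The inexact accelerated proximal point method *)

Section Acceleration.
Variable R : realType.
Implicit Types (n l : nat) (k L mu c a : R).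

(** A state [s = (y, v)] holds the iterate and the centre of the estimate sequence in Nesterov's
    scheme for strongly convex functions. *)
Definition extrapolate n (al : R) (s : 'rV[R]_n * 'rV[R]_n) : 'rV[R]_n :=
  (1 + al)^-1 *: (s.1 + al *: s.2).

(** The last term is a step of length [al / mu'] along the subgradient [H (z - y)], where
    [mu' = 2 * H * al ^+ 2] is the modulus of strong convexity used. *)
Definition momentum n (al : R) (s : 'rV[R]_n * 'rV[R]_n) (y : 'rV[R]_n) :=
  (y, (1 - al) *: s.2 + al *: y - (2 * al)^-1 *: (extrapolate al s - y)).

(** The states live in the second variable only; one more solve at the last extrapolated point
    yields both blocks. *)
Definition accelerate n1 n2 (sol : 'rV[R]_n2 -> 'rV[R]_(n1 + n2)) (al : R) (N : nat)
    (y0 : 'rV[R]_n2) : 'rV[R]_(n1 + n2) :=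
  sol (extrapolate al
    (iter N (fun s => momentum al s (rsubmx (sol (extrapolate al s)))) (y0, y0))).

(** The inequality at [ys] with weight [al] is added to the one at [s.1] with weight [1 - al];
    [extrapolate] and [momentum] are chosen so that the products of [r] with [b] and [p] cancel. *)
Lemma acceleration_step n (al H Fy Fp Fs delta : R) (s : 'rV[R]_n * 'rV[R]_n)
    (yp ys : 'rV[R]_n) :
  0 < al -> al <= 1 / 2 -> 0 <= H ->
  let g := H *: (extrapolate al s - yp) in
  (forall u Fu, u = ys /\ Fu = Fs \/ u = s.1 /\ Fu = Fy ->
     Fp - delta + dot g (u - yp) + H * al ^+ 2 * nsq (u - yp) <= Fu) ->
  Fp - Fs + H * al ^+ 2 * nsq ((momentum al s yp).2 - ys) <=
  (1 - al) * (Fy - Fs + H * al ^+ 2 * nsq (s.2 - ys)) + delta.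
Proof.
case: s => y v al0 al2 H0 g h.
have h1 := h _ _ (or_introl (conj erefl erefl)).
have h2 := h _ _ (or_intror (conj erefl erefl)).
rewrite /= in h1 h2 *; rewrite /g {g h} in h1 h2; set z := extrapolate al (y, v) in h1 h2 *.
pose r := (2 * al)^-1 *: (z - yp); pose p := yp - ys; pose b := v - ys.
have al20 : 2 * al != 0 by rewrite gt_eqF // mulr_gt0.
have a10 : 1 + al != 0 by rewrite gt_eqF //; lra.
have zE : z - yp = (2 * al) *: r by rewrite scalerA mulfV // scale1r.
have yE : y - yp = (1 + al) *: ((2 * al) *: r) + al *: p - al *: b.
  rewrite -zE /z /extrapolate /p /b; apply/rowP => j; rewrite !mxE /=.
  by field.
have -> : (1 - al) *: v + al *: yp - (2 * al)^-1 *: (z - yp) - ys =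
    (1 - al) *: b + al *: p - r.
  by rewrite /r /b /p; apply/rowP => j; rewrite !mxE; ring.
have ysE : ys - yp = - p by rewrite opprB.
rewrite zE ysE in h1; rewrite zE yE in h2; rewrite -/b.
have Hal2 : 0 <= H * al ^+ 2 by rewrite mulr_ge0 ?sqr_ge0.
have h2' : Fp - delta + dot (H *: (2 * al *: r))
   ((1 + al) *: (2 * al *: r) + al *: p - al *: b) <= Fy.
  by apply: le_trans h2; rewrite lerDl mulr_ge0 ?nsq_ge0.
have h1a := ler_wpM2l (ltW al0) h1.
have al1 : 0 <= 1 - al by lra.
have h2a := ler_wpM2l al1 h2'.
(* The slack of the weighted sum is exactly these two terms: the convexity defect of the squared
   norm between [b] and [p], and a multiple of [nsq r] that is nonnegative for [al <= 1 / 2]. *)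
have P1 : 0 <= al * (1 - al) * (H * al ^+ 2) * nsq (b - p).
  by rewrite mulr_ge0 ?nsq_ge0 // mulr_ge0 // mulr_ge0 // ltW.
have P2 : 0 <= (3 - 4 * al ^+ 2) * (H * al ^+ 2) * nsq r.
  rewrite mulr_ge0 ?nsq_ge0 // mulr_ge0 // subr_ge0.
  have : al ^+ 2 <= (1 / 2) ^+ 2 by rewrite ler_sqr ?nnegrE; lra.
  lra.
move: P1 P2 h1a h2a; clearbody r p b; rewrite /nsq !dotE ?(dotC b r) ?(dotC p r) ?(dotC p b).
move: (dot r r) (dot r b) (dot r p) (dot b b) (dot b p) (dot p p) => rr rb rp bb bp pp.
lra.
Qed.

Section Fixed.
Variables (n1 n2 : nat) (mu1 mu2 L c H k al : R).
Variables (K : 'rV[R]_n1 -> 'rV[R]_n2 -> R) (T : 'rV[R]_(n1 + n2) -> 'rV[R]_(n1 + n2)).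
Hypotheses (KT : saddle_op mu1 mu2 L K T) (c0 : 0 < c) (c1 : c <= mu1) (c2 : c <= mu2).
Hypotheses (Lk : L <= k * c) (Hk : H <= k * c) (muH : mu2 <= H) (k16 : 16 <= k).
Hypotheses (al0 : 0 < al) (alE : 4 * H * al ^+ 2 = mu2).
Variable F : 'rV[R]_n2 -> R.
Hypothesis FP : forall y, (forall x, - K x y <= F y) /\ exists x, F y = - K x y.

Let m1 : 0 < mu1. Proof. exact: lt_le_trans c1. Qed.
Let m2 : 0 < mu2. Proof. exact: lt_le_trans c2. Qed.
Let H0 : 0 < H. Proof. exact: lt_le_trans muH. Qed.

Let regularized z := fun w => T w + row_mx 0 (H *: (rsubmx w - z)).

Lemma exist_regularized z : exists w, regularized z w = 0.
Proof.
have KT' := saddle_opD KT (saddle_op_quadr n1 z (ltW H0)).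
have [_ _ Tl] := KT'.
apply: (exist_zero c0 _ Tl); apply: saddle_smono KT'; first by rewrite addr0.
by rewrite (le_trans c2) // lerDl ltW.
Qed.

(* [F] is the primal function [y |-> max_x - K x y]; a point with a small partial
   gradient in [x] gives an approximate subgradient of it, so that [F] need not be
   differentiated. *)
Lemma primal_subgradient w u :
  F (rsubmx w) - (2 * mu1)^-1 * nsq (lsubmx (T w)) + dot (rsubmx (T w)) (u - rsubmx w)
    + mu2 / 2 * nsq (u - rsubmx w) <= F u.
Proof.
have [Kx Ky _] := KT; rewrite -[w]hsubmxK.
move: (lsubmx w) (rsubmx w) => x y; rewrite row_mxKr.
have [_ [x' ->]] := FP y; have [/(_ x) Fu _] := FP u.
have h1 := Kx x x' y; have h2 := Ky x y u.
have mi : 0 < mu1^-1 by rewrite invr_gt0.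
have /andP[+ _] := dot_Young (lsubmx (T (row_mx x y))) (x' - x) mi.
have -> : (2 * mu1)^-1 = mu1^-1 / 2 by rewrite invfM mulrC.
rewrite invrK; lra.
Qed.

(** A Polyak-Lojasiewicz inequality: the strong convexity of [F] absorbs the linear term. It bounds
    the initial potential, and finally converts a small residual into an [eps]-solution. *)
Lemma primal_gap w ys : F (rsubmx w) - F ys <= (2 * c)^-1 * nsq (T w).
Proof.
have h := primal_subgradient w ys.
have mi : 0 < mu2^-1 by rewrite invr_gt0.
have /andP[+ _] := dot_Young (rsubmx (T w)) (ys - rsubmx w) mi; rewrite invrK => h2.
have e1 : (2 * mu1)^-1 * nsq (lsubmx (T w)) <= (2 * c)^-1 * nsq (lsubmx (T w)).
  by rewrite ler_wpM2r ?nsq_ge0 // lef_pV2 ?posrE ?mulr_gt0 // ler_pM2l.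
have e2 : (2 * mu2)^-1 * nsq (rsubmx (T w)) <= (2 * c)^-1 * nsq (rsubmx (T w)).
  by rewrite ler_wpM2r ?nsq_ge0 // lef_pV2 ?posrE ?mulr_gt0 // ler_pM2l.
rewrite nsq_submx; move: e2; rewrite invfM; lra.
Qed.

Let kc0 : 0 <= k * c. Proof. by rewrite mulr_ge0 ?(ltW c0) // (le_trans _ k16). Qed.

Let L2 w w' : nsq (T w - T w') <= (k * c) ^+ 2 * nsq (w - w').
Proof. by have [_ _ /(lipW Lk) Tl] := KT; exact: lip_nsq. Qed.

Let H2 : H ^+ 2 <= (k * c) ^+ 2.
Proof. by rewrite ler_sqr ?nnegrE // ltW. Qed.

(* Half of the strong convexity of [F] absorbs the error of the inner solver. *)
Lemma inexact_prox_subgradient z wz w u : regularized z wz = 0 ->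
  F (rsubmx w) - 5 * k ^+ 2 * c * nsq (w - wz) + dot (H *: (z - rsubmx w)) (u - rsubmx w)
    + mu2 / 4 * nsq (u - rsubmx w) <= F u.
Proof.
move=> wzE; have h := primal_subgradient w u.
have lE : lsubmx (T w) = lsubmx (T w - T wz).
  rewrite raddfB /= (_ : lsubmx (T wz) = 0) ?subr0 //.
  by have := congr1 lsubmx wzE; rewrite raddfD /= row_mxKl addr0 raddf0.
pose e := rsubmx (T w - T wz) + H *: rsubmx (w - wz).
have rE : rsubmx (T w) = e + H *: (z - rsubmx w).
  have := congr1 rsubmx wzE; rewrite raddfD /= row_mxKr raddf0 /e !raddfB /=.
  move/eqP; rewrite addr_eq0 => /eqP ->.
  by apply/rowP => j; rewrite !mxE; ring.
have E0 := nsq_ge0 (w - wz); have L2' := L2 w wz.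
have e4 : nsq e <= 4 * (k * c) ^+ 2 * nsq (w - wz).
  apply: le_trans (nsqD_le _ _) _; rewrite nsqZ.
  have h1 := nsq_rsub_le (T w - T wz); have h2 := nsq_rsub_le (w - wz).
  have := ler_pM (sqr_ge0 H) (nsq_ge0 (rsubmx (w - wz))) H2 h2; lra.
have l1 := nsq_lsub_le (T w - T wz); rewrite -lE in l1.
have mi : 0 < 2 * mu2^-1 by rewrite mulr_gt0 ?invr_gt0.
have /andP[+ _] := dot_Young e (u - rsubmx w) mi.
have -> : (2 * mu2^-1)^-1 = mu2 / 2 by rewrite invfM invrK mulrC.
have kE : (k * c) ^+ 2 = k ^+ 2 * c * c by ring.
have b3 : 0 <= k ^+ 2 * c * nsq (w - wz).
  by apply: mulr_ge0 => //; apply: mulr_ge0; [exact: sqr_ge0 | exact: ltW].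
have b1 : (2 * mu1)^-1 * nsq (lsubmx (T w)) <= k ^+ 2 * c * nsq (w - wz) / 2.
  rewrite mulrC ler_pdivrMr ?mulr_gt0 //; apply: le_trans l1 (le_trans L2' _).
  rewrite kE; have : 0 <= k ^+ 2 * c * nsq (w - wz) * (mu1 - c).
    by apply: mulr_ge0 => //; rewrite subr_ge0.
  lra.
have b2 : mu2^-1 * nsq e <= 4 * (k ^+ 2 * c * nsq (w - wz)).
  rewrite mulrC ler_pdivrMr //; apply: le_trans e4 _.
  rewrite kE; have : 0 <= k ^+ 2 * c * nsq (w - wz) * (mu2 - c).
    by apply: mulr_ge0 => //; rewrite subr_ge0.
  lra.
move: h; rewrite rE dotDl; lra.
Qed.

(** Strong monotonicity between [wz] and [ws] is tested against the regularization term; completing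
    the square [s - 2 *: q] gives [c |wz - ws|^2 <= H / 4 |z - ys|^2], and [H <= k * c]. *)
Lemma regularized_dist z wz ws : T ws = 0 -> regularized z wz = 0 ->
  nsq (wz - ws) <= k * nsq (z - rsubmx ws).
Proof.
move=> wsE wzE; have h := saddle_smono c1 c2 KT wz ws.
have TE : T wz = - row_mx 0 (H *: (rsubmx wz - z)) by apply/eqP; rewrite -addr_eq0; apply/eqP.
move: h; rewrite wsE TE subr0 opp_row_mx oppr0 dot_submx row_mxKl dot0l add0r row_mxKr.
rewrite [rsubmx (wz - ws)]raddfB /=.
have -> : rsubmx wz - z = (rsubmx wz - rsubmx ws) - (z - rsubmx ws).
  by rewrite opprB addrA subrK.
move: (z - rsubmx ws) (rsubmx wz - rsubmx ws) => s q h.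
have : 0 <= H * nsq (s - 2 *: q) by rewrite mulr_ge0 ?nsq_ge0 // ltW.
have : 0 <= (k * c - H) * nsq s by rewrite mulr_ge0 ?nsq_ge0 // subr_ge0.
have : 0 <= k * c * nsq s by rewrite mulr_ge0 ?nsq_ge0.
have -> : (nsq (wz - ws) <= k * nsq s) = (c * nsq (wz - ws) <= c * (k * nsq s)) by rewrite ler_pM2l.
move: h; rewrite /nsq !dotE (dotC q s); lra.
Qed.

Let k0 : 0 < k. Proof. exact: lt_le_trans k16. Qed.

Let alH : H * al ^+ 2 = mu2 / 4. Proof. by rewrite -alE; field. Qed.

Lemma momentum_le_half : al <= 1 / 2.
Proof.
rewrite -ler_sqr ?nnegrE ?divr_ge0 ?(ltW al0) // -(ler_pM2l H0) alH.
have := muH; have := H0; lra.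
Qed.

(** Allows an additive error to be charged to the fraction [al] of the potential that a step
    removes. *)
Lemma momentum_lower_bound : 1 <= al * (2 * k).
Proof.
have k1 := k16; have kc := mulr_gt0 k0 c0.
rewrite -ler_sqr ?nnegrE ?mulr_ge0 ?(ltW al0) ?(ltW k0) // -(ler_pM2l H0) expr1n.
have -> : H * (al * (2 * k)) ^+ 2 = mu2 * k ^+ 2 by rewrite -alE; ring.
have h1 : k * mu2 <= mu2 * k ^+ 2 by rewrite mulrC ler_pM2l // expr2 ler_peMl //; lra.
have h2 : k * c <= k * mu2 by rewrite ler_pM2l.
have := Hk; lra.
Qed.

Section Potential.
Variable ws : 'rV[R]_(n1 + n2).
Hypothesis wsE : T ws = 0.
Let ys := rsubmx ws.

Let potential (s : 'rV[R]_n2 * 'rV[R]_n2) :=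
  F s.1 - F ys + H * al ^+ 2 * nsq (s.2 - ys).

Lemma extrapolate_dist s : c * nsq (extrapolate al s - ys) <= 4 * potential s.
Proof.
case: s => y v; rewrite /potential /=.
have := primal_subgradient ws y; rewrite wsE !raddf0 nsq0 mulr0 subr0 dot0l addr0 -/ys => h.
have a1 : 1 + al != 0 by rewrite gt_eqF // addr_gt0.
have -> : extrapolate al (y, v) - ys = (1 + al)^-1 *: ((y - ys) + al *: (v - ys)).
  by rewrite /extrapolate; apply/rowP => j; rewrite !mxE /=; field.
rewrite alH; move: h; move: (y - ys) (v - ys) => a b h.
have n1' : nsq (a + al *: b) <= (1 + al) ^+ 2 * (nsq a + nsq b).
  have := nsq_ge0 a; have := nsq_ge0 b; have := mulr_ge0 (ltW al0) (nsq_ge0 (a - b)).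
  have := mulr_ge0 (ltW al0) (nsq_ge0 b); have := mulr_ge0 (ltW al0) (nsq_ge0 a).
  have := mulr_ge0 (sqr_ge0 al) (nsq_ge0 a).
  by rewrite /nsq !dotE (dotC b a); lra.
have {}n1' : (1 + al)^-1 ^+ 2 * nsq (a + al *: b) <= nsq a + nsq b.
  by rewrite exprVn mulrC ler_pdivrMr ?exprn_gt0 ?addr_gt0 // mulrC.
rewrite nsqZ; apply: le_trans (ler_wpM2l (ltW c0) n1') _.
have mc : c * (nsq a + nsq b) <= mu2 * (nsq a + nsq b).
  by rewrite ler_wpM2r // addr_ge0 ?nsq_ge0.
have := mulr_ge0 (ltW m2) (nsq_ge0 a); lra.
Qed.

Variables (w0 : 'rV[R]_(n1 + n2)) (sol : 'rV[R]_n2 -> 'rV[R]_(n1 + n2)).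
Hypothesis solP : forall z, solves (k ^+ 7) w0 (regularized z) (sol z).
Let D := nsq (w0 - ws).
Let t := k^-1.

Let t0 : 0 < t. Proof. by rewrite invr_gt0. Qed.
Let t16 : t <= 16^-1. Proof. by rewrite lef_pV2 ?posrE. Qed.
Let D0 : 0 <= D. Proof. exact: nsq_ge0. Qed.

(** The solver is accurate relative to [w0], and [regularized_dist] keeps the inner solution near
    [ws]; the error is thus controlled by [D] and the potential. The factor [t ^+ 14] is the squared
    accuracy [k ^- 7]. *)
Lemma inner_error s p : potential s <= p * (c * D) -> exists wz,
  [/\ regularized (extrapolate al s) wz = 0, nsq (wz - ws) <= 4 * k * p * D
    & nsq (sol (extrapolate al s) - wz) <= 2 * t ^+ 14 * (1 + 4 * k * p) * D].
Proof.
move=> sp; set z := extrapolate al s; have [wz wzE] := exist_regularized z; exists wz.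
have h1 := regularized_dist wsE wzE; rewrite -/ys in h1.
have h2 : nsq (z - ys) <= 4 * p * D.
  rewrite -(ler_pM2l c0); apply: le_trans (extrapolate_dist s) _; lra.
have h3 : nsq (wz - ws) <= 4 * k * p * D.
  apply: le_trans h1 _; have := ler_wpM2l (ltW k0) h2; lra.
split=> //; have := solP wzE; rewrite enorm_le ?mulr_ge0 ?enorm_ge0 ?invr_ge0 ?exprn_ge0 ?(ltW k0) //.
rewrite exprMn enorm_sqr -exprVn -exprM -/t => /le_trans; apply.
have h4 : nsq (w0 - wz) <= 2 * (1 + 4 * k * p) * D.
  have -> : w0 - wz = (w0 - ws) + - (wz - ws) by rewrite opprB addrA subrK.
  apply: le_trans (nsqD_le _ _) _; rewrite nsqN -/D; lra.
have t14 : 0 <= t ^+ 14 by rewrite exprn_ge0 // ltW.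
have := ler_wpM2l t14 h4; lra.
Qed.

(** For [p <= 2 * k ^+ 2] the squared inner error is at most [18 * t ^+ 11 * D], and the factor
    [5 * k ^+ 2 * c] makes it [90 * t ^+ 9 * (c * D)]. As [al >= t / 2], this is at most
    [al * (180 * t ^+ 8)], a floor that the recursion does not go below. *)
Lemma potential_decrease s p : 0 <= p <= 2 * k ^+ 2 -> potential s <= p * (c * D) ->
  potential (momentum al s (rsubmx (sol (extrapolate al s)))) <=
  ((1 - al) * p + al * (180 * t ^+ 8)) * (c * D).
Proof.
move=> /andP[p0 p2] sp; have [wz [wzE _ e]] := inner_error sp.
set z := extrapolate al s in wzE e; set w := sol z in e *.
have cD : 0 <= c * D by rewrite mulr_ge0 // ltW.
have h := acceleration_step (Fp := F (rsubmx w)) (delta := 5 * k ^+ 2 * c * nsq (w - wz)) (s := s)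
   al0 momentum_le_half (ltW H0).
have {}h := h (F s.1) (F ys) (rsubmx w) ys.
apply: le_trans (h _) _.
  move=> u Fu; rewrite alH => uE.
  have -> : Fu = F u by case: uE => -[-> ->].
  exact: inexact_prox_subgradient.
rewrite [X in _ <= X]mulrDl; apply: lerD.
  rewrite -[X in _ <= X]mulrA; apply: ler_wpM2l; last exact: sp.
  have := momentum_le_half; lra.
have d1 : 5 * k ^+ 2 * c * nsq (w - wz) <= 90 * t ^+ 9 * (c * D).
  have e2 : 2 * t ^+ 14 * (1 + 4 * k * p) * D <= 18 * t ^+ 11 * D.
    apply: ler_wpM2r => //.
    have -> : t ^+ 11 = t ^+ 14 * k ^+ 3 by rewrite /t; field; rewrite gt_eqF.
    have -> : 18 * (t ^+ 14 * k ^+ 3) = 2 * t ^+ 14 * (9 * k ^+ 3) by ring.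
    apply: ler_wpM2l; first by rewrite mulr_ge0 ?exprn_ge0 // ltW.
    have k1 := k16; have := ler_wpM2l (ltW k0) p2.
    have : 1 <= k ^+ 3 by rewrite exprn_ege1 //; lra.
    rewrite (exprS k 2); lra.
  have kk : 0 <= 5 * k ^+ 2 * c by rewrite !mulr_ge0 ?exprn_ge0 ?(ltW k0) ?(ltW c0).
  apply: le_trans (ler_wpM2l kk (le_trans e e2)) _.
  rewrite le_eqVlt; apply/orP; left; apply/eqP.
  by rewrite /t; field; rewrite gt_eqF.
apply: le_trans d1 _; apply: ler_wpM2r => //.
have -> : t ^+ 9 = t ^+ 8 * t by rewrite exprSr.
have : 1 * (180 * t ^+ 8 * t) <= al * (2 * k) * (180 * t ^+ 8 * t).
  apply: ler_wpM2r momentum_lower_bound.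
  by rewrite !mulr_ge0 ?exprn_ge0 ?(ltW t0).
have -> : al * (2 * k) * (180 * t ^+ 8 * t) = 2 * (al * (180 * t ^+ 8)).
  by rewrite /t; field; rewrite gt_eqF.
lra.
Qed.

(** The exponent 6: the initial potential may reach [k ^+ 2 * (c * D)], and passing from potential
    to distance costs another [k]. This leaves [t ^+ 3], whose spare factor [t <= 1 / 16] pays for
    the constants. *)
Lemma accelerate_dist N : (1 - al) ^+ N <= t ^+ 6 ->
  nsq (accelerate sol al N (rsubmx w0) - ws) <= t ^+ 2 * D.
Proof.
move=> Nt; pose s j := iter j (fun s => momentum al s (rsubmx (sol (extrapolate al s))))
  (rsubmx w0, rsubmx w0).
have cD : 0 <= c * D by rewrite mulr_ge0 // ltW.
have al1 := momentum_le_half; have t1 := t0; have a0 := al0; have t2 := t16.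
have tt : 0 <= t ^+ 8 by rewrite exprn_ge0 // ltW.
have tle j : t ^+ j <= 1 by rewrite exprn_ile1 //; lra.
have k2 : 256 <= k ^+ 2.
  have : 16 ^+ 2 <= k ^+ 2 by rewrite ler_sqr ?nnegrE ?(ltW k0).
  lra.
(* [180 * t ^+ 8] is the fixed point of the recursion in [potential_decrease], so only the first
   summand decays. *)
have inv j : potential (s j) <= ((1 - al) ^+ j * k ^+ 2 + 180 * t ^+ 8) * (c * D).
  elim: j => [|j IH].
    rewrite expr0 mul1r /potential /= alH.
    have g := primal_gap w0 ys.
    have d1 : nsq (rsubmx w0 - ys) <= D by rewrite /ys -raddfB; exact: nsq_rsub_le.
    have TL := L2 w0 ws; rewrite wsE subr0 -/D in TL.
    have g2 : (2 * c)^-1 * nsq (T w0) <= k ^+ 2 / 2 * (c * D).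
      rewrite mulrC ler_pdivrMr ?mulr_gt0 //; apply: le_trans TL _.
      by rewrite le_eqVlt; apply/orP; left; apply/eqP; field.
    have mk : mu2 / 4 * nsq (rsubmx w0 - ys) <= k ^+ 2 / 4 * (c * D).
      have m : mu2 * nsq (rsubmx w0 - ys) <= k * c * D.
        by apply: ler_pM (ltW m2) (nsq_ge0 _) (le_trans muH Hk) d1.
      have : k * (c * D) <= k ^+ 2 * (c * D).
        apply: ler_wpM2r => //; rewrite expr2 ler_peMl ?(ltW k0) //.
        have := k16; lra.
      lra.
    have : 0 <= 180 * t ^+ 8 * (c * D) by rewrite mulr_ge0 // mulr_ge0.
    have : 0 <= k ^+ 2 * (c * D) by rewrite mulr_ge0 ?sqr_ge0.
    lra.
  rewrite /s iterS -/(s j).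
  have pj : (1 - al) ^+ j <= 1 by rewrite exprn_ile1; lra.
  have qj : 0 <= (1 - al) ^+ j by rewrite exprn_ge0 //; lra.
  have pk : (1 - al) ^+ j * k ^+ 2 <= k ^+ 2 by rewrite ler_piMl ?sqr_ge0.
  have qk : 0 <= (1 - al) ^+ j * k ^+ 2 by rewrite mulr_ge0 ?sqr_ge0.
  have pp : 0 <= (1 - al) ^+ j * k ^+ 2 + 180 * t ^+ 8 <= 2 * k ^+ 2.
    by have := tle 8; move=> t8; apply/andP; split; lra.
  apply: le_trans (potential_decrease pp IH) _.
  apply: ler_wpM2r => //; rewrite (exprS _ j); lra.
have [wz [wzE d1 d2]] := inner_error (inv N).
set w := sol _ in d2; have -> : accelerate sol al N (rsubmx w0) = w by [].
have -> : w - ws = (w - wz) + (wz - ws) by rewrite addrA subrK.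
apply: le_trans (nsqD_le _ _) _.
set p := (1 - al) ^+ N * k ^+ 2 + _ in d1 d2.
have kp : k * p <= t ^+ 3 + 180 * t ^+ 7.
  have -> : t ^+ 3 = k ^+ 3 * t ^+ 6 by rewrite /t; field; rewrite gt_eqF.
  have -> : t ^+ 7 = k * t ^+ 8 by rewrite /t; field; rewrite gt_eqF.
  have : k ^+ 3 * (1 - al) ^+ N <= k ^+ 3 * t ^+ 6.
    by rewrite ler_wpM2l // exprn_ge0 // ltW.
  rewrite /p (exprS k 2); lra.
have kD := ler_wpM2r D0 kp.
have t14 : t ^+ 14 <= t ^+ 7 by rewrite (exprD t 7 7) ler_piMl ?exprn_ge0 ?(ltW t0).
have d3 : 2 * t ^+ 14 * (1 + 4 * k * p) * D <= 2 * t ^+ 7 * (1 + 4 + 720) * D.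
  apply: ler_wpM2r => //; apply: ler_pM.
  - by rewrite mulr_ge0 ?exprn_ge0 ?(ltW t0).
  - have : 0 <= k * p.
      have qj : 0 <= (1 - al) ^+ N by rewrite exprn_ge0 //; lra.
      by rewrite mulr_ge0 ?(ltW k0) // addr_ge0 // mulr_ge0 ?sqr_ge0.
    lra.
  - lra.
  - have := tle 3; have := tle 7; lra.
have t7 : t ^+ 7 <= 16^-1 ^+ 5 * t ^+ 2.
  rewrite (exprD t 5 2); apply: ler_wpM2r; first exact: sqr_ge0.
  by apply: lerXn2r; rewrite ?nnegrE ?(ltW t0) //; lra.
have t3 : t ^+ 3 <= 16^-1 * t ^+ 2 by rewrite exprS; apply: ler_wpM2r; first exact: sqr_ge0.
have t7D := ler_wpM2r D0 t7; have t3D := ler_wpM2r D0 t3.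
have tD : 0 <= t ^+ 2 * D by rewrite mulr_ge0 ?sqr_ge0.
lra.
Qed.

End Potential.

End Fixed.
End Acceleration.

(** * Iteration counts of acceleration, and proximal steps *)

Section AcceleratedSolvers.
Variable R : realType.
Implicit Types (n l : nat) (k L mu c a H : R).

(** The root of [4 * H * al ^+ 2 = mu]: the potential carries the weight [mu / 4], half of the
    quadratic term of strong convexity, and inner errors consume the other half. *)
Definition momentum_rate mu H : R := Num.sqrt (mu / (4 * H)).

Definition half_life mu H : nat := (Num.truncn (momentum_rate mu H)^-1).+1.

(** The successor in [half_life] ensures [al * M >= 1] for the number [M] of steps; Bernoulli's
    inequality gives [(1 + al) ^+ M >= 2], while [(1 - al) * (1 + al) <= 1]. *)
Lemma half_lifeP mu H : 0 < mu -> mu <= H ->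
  (1 - momentum_rate mu H) ^+ half_life mu H <= 2^-1.
Proof.
move=> mu0 muH; have H0 := lt_le_trans mu0 muH.
set al := momentum_rate mu H.
have al0 : 0 < al by rewrite sqrtr_gt0 divr_gt0 // mulr_gt0.
have al1 : al <= 1.
  rewrite -sqrtr1 ler_wsqrtr // ler_pdivrMr ?mulr_gt0 //; lra.
have b : 1 <= al * (half_life mu H)%:R.
  rewrite mulrC -ler_pdivrMr // div1r; apply/ltW.
  exact: Num.Theory.truncnS_gt.
move: (half_life mu H) b => M b.
have b2 : 2 <= (1 + al) ^+ M.
  suff : 1 + al * M%:R <= (1 + al) ^+ M by lra.
  elim: (M) => [|j IH]; first by rewrite mulr0 addr0 expr0.
  have a1 : 0 <= 1 + al by lra.
  have := ler_wpM2l a1 IH; have : 0 <= al * (al * j%:R) by rewrite !mulr_ge0 ?(ltW al0).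
  rewrite exprS -natr1; lra.
have b0 : 0 < (1 + al) ^+ M by lra.
rewrite -(ler_pM2r b0) -exprMn.
apply: (@le_trans _ _ 1).
  rewrite exprn_ile1 //; first by rewrite mulr_ge0 //; lra.
  have := sqr_ge0 al; lra.
lra.
Qed.

Lemma half_life_le mu H : 0 < mu -> mu <= H ->
  (half_life mu H)%:R <= 3 * Num.sqrt (H / mu).
Proof.
move=> mu0 muH; have H0 := lt_le_trans mu0 muH.
have s1 : 1 <= Num.sqrt (H / mu).
  by rewrite -{1}sqrtr1 ler_wsqrtr // ler_pdivlMr // mul1r.
have E : (momentum_rate mu H)^-1 = 2 * Num.sqrt (H / mu).
  rewrite /momentum_rate -sqrtrV ?divr_ge0 ?mulr_ge0 ?(ltW mu0) ?(ltW H0) //.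
  have -> : (mu / (4 * H))^-1 = 2 ^+ 2 * (H / mu) by field; rewrite !gt_eqF.
  by rewrite sqrtrM ?sqr_ge0 // sqrtr_sqr ger0_norm.
rewrite /half_life -natr1 E.
have : (Num.truncn (2 * Num.sqrt (H / mu)))%:R <= 2 * Num.sqrt (H / mu).
  rewrite Num.Theory.truncn_le // mulr_ge0 ?sqrtr_ge0 //.
lra.
Qed.

(** [6 * l] half-lives bring the decay factor down to [2 ^- (6 * l) = k ^- 6], as [accelerate_dist]
    requires. *)
Theorem acceleration n1 n2 mu1 mu2 L c H l (K : 'rV[R]_n1 -> 'rV[R]_n2 -> R) T w0 sol :
  let k : R := 2 ^+ l in
  saddle_op mu1 mu2 L K T -> 0 < c -> c <= mu1 -> c <= mu2 -> L <= k * c -> H <= k * c ->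
  mu2 <= H -> 16 <= k ->
  (forall z, solves (2 ^+ (7 * l)) w0 (fun w => T w + row_mx 0 (H *: (rsubmx w - z))) (sol z)) ->
  solves k w0 T (accelerate sol (momentum_rate mu2 H) (6 * l * half_life mu2 H) (rsubmx w0)).
Proof.
rewrite [(7 * l)%N]mulnC exprM => k KT c0 c1 c2 Lk Hk muH k16 solP ws wsE.
have m1 := lt_le_trans c0 c1; have m2 := lt_le_trans c0 c2; have H0 := lt_le_trans m2 muH.
have k0 : 0 < k by exact: lt_le_trans k16.
have [F FP] := saddle_primal m1 KT.
set al := momentum_rate mu2 H.
have al0 : 0 < al by rewrite sqrtr_gt0 divr_gt0 // mulr_gt0.
have alE : 4 * H * al ^+ 2 = mu2.
  rewrite sqr_sqrtr ?divr_ge0 ?mulr_ge0 ?(ltW m2) ?(ltW H0) //; field; exact: lt0r_neq0.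
rewrite enorm_le ?mulr_ge0 ?enorm_ge0 ?invr_ge0 ?(ltW k0) // exprMn enorm_sqr.
apply: (accelerate_dist KT c0 c1 c2 Lk Hk muH k16 al0 alE FP wsE solP).
have al1 : 0 <= 1 - al.
  by rewrite subr_ge0 (le_trans (momentum_le_half c0 c2 muH al0 alE)) //; lra.
have -> : k^-1 ^+ 6 = 2^-1 ^+ (6 * l) by rewrite /k -exprVn -exprM mulnC.
rewrite [(_ * half_life _ _)%N]mulnC exprM.
apply: lerXn2r; rewrite ?nnegrE ?exprn_ge0 ?invr_ge0 //.
exact: half_lifeP.
Qed.

Theorem acceleration_x n1 n2 mu1 mu2 L c H l (K : 'rV[R]_n1 -> 'rV[R]_n2 -> R) T w0 sol :
  let k : R := 2 ^+ l in
  saddle_op mu1 mu2 L K T -> 0 < c -> c <= mu1 -> c <= mu2 -> L <= k * c -> H <= k * c ->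
  mu1 <= H -> 16 <= k ->
  (forall z, solves (2 ^+ (7 * l)) w0 (fun w => T w + row_mx (H *: (lsubmx w - z)) 0) (sol z)) ->
  solves k w0 T (swap (accelerate (fun z => swap (sol z)) (momentum_rate mu1 H)
    (6 * l * half_life mu1 H) (lsubmx w0))).
Proof.
move=> k KT c0 c1 c2 Lk Hk muH k16 solP; apply: solves_swap.
have -> : lsubmx w0 = rsubmx (swap w0) by rewrite row_mxKr.
apply: (acceleration (saddle_op_swap KT) c0) => // z.
apply: solves_swap; rewrite swapK; apply: solves_ext (solP z) => w.
rewrite swapK /swap !raddfD /= !row_mxKl !row_mxKr -!/(swap _).
by rewrite -{1}[T w]hsubmxK add_row_mx addr0.
Qed.

Lemma rsubmx_thin n (w : 'rV[R]_(0 + n)) : rsubmx w = w.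
Proof. by apply/rowP => j; rewrite mxE; congr (w 0 _); apply/val_inj. Qed.

Lemma row_mx_thin n (x : 'rV[R]_0) (y : 'rV[R]_n) : row_mx x y = y.
Proof. by rewrite -[LHS]rsubmx_thin row_mxKr. Qed.

Lemma gradient_smono0 n (F : 'rV[R]_n -> R) gF :
  (forall x x', F x + dot (gF x) (x' - x) <= F x') -> smono 0 gF.
Proof.
move=> h x x'; have := h x x'; have := h x' x.
by rewrite -(opprB x x') dotNr dotDl dotNl; lra.
Qed.

(** The zero [p] of the affine map [H (p - w) + g + a (p - ctr) + H (p - z)]: a backward step in
    closed form. *)
Definition prox_step n a H (ctr z w g : 'rV[R]_n) : 'rV[R]_n :=
  (2 * H + a)^-1 *: (H *: (w + z) + a *: ctr - g).

(* A minimization problem is a saddle problem whose first block has dimension zero;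
   the proximal subproblems are well conditioned, hence solved by gradient steps. *)
Theorem prox_solves n (F : 'rV[R]_n -> R) gF M a l (ctr w0 : 'rV[R]_n) :
  let k : R := 2 ^+ l in let H := M + a in
  (forall x x', F x + dot (gF x) (x' - x) <= F x') -> lip M gF -> 0 <= M -> 0 < a ->
  16 <= k -> H <= k * a ->
  solves k w0 (fun p => gF p + a *: (p - ctr))
    (accelerate (n1 := 0)
      (fun z => iter (6 * (7 * l)) (fun w => prox_step a H ctr z w (gF w)) w0)
      (momentum_rate a H) (6 * l * half_life a H) w0).
Proof.
move=> k H Fconv gl M0 a0 k16 Hk.
have H0 : 0 < H by rewrite ltr_wpDl.
pose K (x : 'rV[R]_0) (y : 'rV[R]_n) := - (F y + a / 2 * nsq (y - ctr)).
pose T (w : 'rV[R]_(0 + n)) : 'rV[R]_(0 + n) := gF w + a *: (w - ctr).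
have gm := gradient_smono0 Fconv.
have KT : saddle_op a a H K T.
  split.
  - move=> x x' y; rewrite (thinmx0 (x' - x)) dot0r nsq0 mulr0 !addr0.
    exact: lexx.
  - move=> x y y'; rewrite rsubmx_thin row_mx_thin /K /T.
    have -> : y' - ctr = (y' - y) + (y - ctr) by rewrite addrA subrK.
    have := Fconv y y'; rewrite dotDl dotZl.
    by move: (y' - y) (y - ctr) => u v; rewrite /nsq !dotE (dotC v u); lra.
  - apply: lipD => // u v; rewrite -scalerBr opprB addrA subrK enormZ ger0_norm //.
    exact: ltW.
have aH : a <= H by rewrite lerDr.
pose sol z : 'rV[R]_(0 + n) := iter (6 * (7 * l)) (fun w => prox_step a H ctr z w (gF w)) w0.
have := @acceleration 0 n a a H a H l K T w0 sol KT a0 (lexx a) (lexx a) Hk Hk aH k16.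
rewrite rsubmx_thin; apply => z.
apply: (@solves_ext _ _ _ _ (fun p => gF p + (a *: (p - ctr) + H *: (p - z)))) => [w|].
  by rewrite rsubmx_thin row_mx_thin /T addrA.
have aff (b : R) (e : 'rV[R]_n) : smono b (fun p => b *: (p - e)).
  by move=> u v; rewrite -scalerBr opprB addrA subrK dotZl.
have affl (b : R) (e : 'rV[R]_n) : 0 <= b -> lip b (fun p => b *: (p - e)).
  by move=> b0 u v; rewrite -scalerBr opprB addrA subrK enormZ ger0_norm.
have Bm : smono H (fun p => a *: (p - ctr) + H *: (p - z)).
  by apply: (smonoW _ (smonoD (aff a ctr) (aff H z))); rewrite lerDr ltW.
have Bl := lipD (affl a ctr (ltW a0)) (affl H z (ltW H0)).
have gH : lip H gF by apply: lipW gl; rewrite lerDl ltW.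
apply: (forward_backward H0 gm gH Bm Bl).
  rewrite mulnC exprM (le_trans k16) // -/k; apply: ler_eXnr => //.
  lra.
move=> w; apply: (@solves_exact _ _ _ H) => //.
  have := smonoD (aff H w) Bm.
  move=> sm u v; apply: le_trans (le_trans (sm u v) _).
    by rewrite ler_wpM2r ?nsq_ge0 // lerDr ltW.
  rewrite le_eqVlt; apply/orP; left; apply/eqP; congr dot.
  by apply/rowP => j; rewrite !mxE; ring.
rewrite /prox_step; apply/rowP => j; rewrite !mxE; field.
by rewrite gt_eqF // addr_gt0 // mulr_gt0.
Qed.

End AcceleratedSolvers.

(** * Composite saddle problems with a separable part *)

Section CompositeSaddle.
Variable R : realType.
Implicit Types (n l : nat) (k L mu c a b : R).

Definition sc_grad n mu L (F : 'rV[R]_n -> R) (gF : 'rV[R]_n -> 'rV[R]_n) : Prop :=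
  (forall x x', F x + dot (gF x) (x' - x) + mu / 2 * nsq (x' - x) <= F x') /\ lip L gF.

Lemma sc_grad_smono n mu L F (gF : 'rV[R]_n -> 'rV[R]_n) : sc_grad mu L F gF -> smono mu gF.
Proof.
move=> [h _] x x'; have := h x x'; have := h x' x.
by rewrite -(opprB x x') !nsqN !dotNr dotDl dotNl; lra.
Qed.

Lemma sc_gradD n mu L F mu' L' F' (gF gF' : 'rV[R]_n -> 'rV[R]_n) :
  sc_grad mu L F gF -> sc_grad mu' L' F' gF' ->
  sc_grad (mu + mu') (L + L') (fun x => F x + F' x) (fun x => gF x + gF' x).
Proof.
move=> [h l] [h' l']; split; last exact: lipD.
by move=> x x'; have := h x x'; have := h' x x'; rewrite dotDl; lra.
Qed.

Lemma sc_grad_quad n a (z : 'rV[R]_n) : 0 <= a ->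
  sc_grad a a (fun x => a / 2 * nsq (x - z)) (fun x => a *: (x - z)).
Proof.
move=> a0; split.
- move=> x x'; rewrite dotZl; have -> : x' - z = (x' - x) + (x - z) by rewrite addrA subrK.
  by move: (x' - x) (x - z) => u v; rewrite /nsq !dotE (dotC v u); lra.
- by move=> u v; rewrite -scalerBr opprB addrA subrK enormZ ger0_norm.
Qed.

Lemma sc_gradW n mu L mu' L' F (gF : 'rV[R]_n -> 'rV[R]_n) :
  mu' <= mu -> L <= L' -> sc_grad mu L F gF -> sc_grad mu' L' F gF.
Proof.
move=> m LL [h l]; split; last exact: lipW l.
move=> x x'; apply: le_trans (h x x'); rewrite lerD2l.
by apply: ler_wpM2r; [exact: nsq_ge0 | lra].
Qed.

Variables (n1 n2 : nat).
Implicit Types (phi : 'rV[R]_n1 -> 'rV[R]_n1) (psi : 'rV[R]_n2 -> 'rV[R]_n2).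

Definition separable phi psi (w : 'rV[R]_(n1 + n2)) : 'rV[R]_(n1 + n2) :=
  row_mx (phi (lsubmx w)) (psi (rsubmx w)).

Lemma saddle_op_separable mu1 mu2 L1 L2 F H phi psi : 0 <= L1 -> 0 <= L2 ->
  sc_grad mu1 L1 F phi -> sc_grad mu2 L2 H psi ->
  saddle_op mu1 mu2 (L1 + L2) (fun x y => F x - H y) (separable phi psi).
Proof.
move=> L10 L20 [hF lF] [hH lH]; split.
- by move=> x x' y; rewrite /separable !row_mxKl; have := hF x x'; lra.
- by move=> x y y'; rewrite /separable !row_mxKr; have := hH y y'; lra.
- move=> u v; rewrite /separable opp_row_mx add_row_mx mulrDl.
  have -> x y : row_mx x y = row_mx x 0 + row_mx 0 y :> 'rV[R]_(n1 + n2).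
    by rewrite add_row_mx addr0 add0r.
  apply: le_trans (enormD _ _) _; apply: lerD.
    rewrite enormE nsq_row nsq0 addr0 -enormE; apply: le_trans (lF _ _) _.
    by rewrite -raddfB ler_wpM2l // !enormE ler_wsqrtr // nsq_lsub_le.
  rewrite enormE nsq_row nsq0 add0r -enormE; apply: le_trans (lH _ _) _.
  by rewrite -raddfB ler_wpM2l // !enormE ler_wsqrtr // nsq_rsub_le.
Qed.

Lemma solves_row k (x0 x : 'rV[R]_n1) (y0 y : 'rV[R]_n2) phi psi : 0 < k ->
  solves k x0 phi x -> solves k y0 psi y ->
  solves k (row_mx x0 y0) (separable phi psi) (row_mx x y).
Proof.
move=> k0 hx hy ws; rewrite -(row_mx0 _ 1 n1 n2) => /eq_row_mx [xs ys].
have := hx _ xs; have := hy _ ys; rewrite -(hsubmxK ws) row_mxKl row_mxKr.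
rewrite !opp_row_mx !add_row_mx.
rewrite !enorm_le ?mulr_ge0 ?enorm_ge0 ?invr_ge0 ?(ltW k0) // !exprMn !enorm_sqr !nsq_row.
lra.
Qed.

(** The resolvent of a separable operator splits into two independent proximal steps, both taken at
    the blocks of the forward point [u]. *)
Lemma forward_backward_separable L L1 L2 F H G gG phi psi l w0
    (rx : 'rV[R]_n1 -> 'rV[R]_n1) (ry : 'rV[R]_n2 -> 'rV[R]_n2) :
  let k : R := 2 ^+ l in
  0 < L -> saddle_op 0 0 L G gG -> sc_grad L L1 F phi -> sc_grad L L2 H psi ->
  0 <= L1 -> 0 <= L2 -> 16 <= k ->
  (forall u, solves (2 ^+ (2 * l)) (lsubmx w0) (fun p => phi p + L *: (p - u)) (rx u)) ->
  (forall u, solves (2 ^+ (2 * l)) (rsubmx w0) (fun p => psi p + L *: (p - u)) (ry u)) ->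
  solves k w0 (fun w => gG w + separable phi psi w)
    (iter (6 * l) (fun w => let u := w - L^-1 *: gG w in
       row_mx (rx (lsubmx u)) (ry (rsubmx u))) w0).
Proof.
move=> k L0 GG hphi hpsi L10 L20 k16 rxP ryP.
have [_ _ gl] := GG; have gm := saddle_smono (lexx 0) (lexx 0) GG.
have SS := saddle_op_separable L10 L20 hphi hpsi.
have Bm := saddle_smono (lexx L) (lexx L) SS; have [_ _ Bl] := SS.
apply: (forward_backward L0 gm gl Bm Bl k16) => w.
set u := w - _; rewrite -[w0]hsubmxK.
have k2 : 0 < (2 : R) ^+ (2 * l) by rewrite exprn_gt0.
apply: solves_ext (solves_row k2 (rxP (lsubmx u)) (ryP (rsubmx u))) => p.
rewrite /separable -add_row_mx addrC; congr (_ + _).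
have -> : L *: (p - w) + gG w = L *: (p - u).
  by rewrite /u; apply/rowP => j; rewrite !mxE; field; rewrite gt_eqF.
by rewrite -!raddfB -!linearZ /= hsubmxK.
Qed.

Lemma merge_quadratics n a b (c u p : 'rV[R]_n) : 0 < a + b ->
  a *: (p - c) + b *: (p - u) = (a + b) *: (p - (a + b)^-1 *: (a *: c + b *: u)).
Proof.
by move=> ab; apply/rowP => j; rewrite !mxE; field; rewrite gt_eqF.
Qed.

End CompositeSaddle.

(** * Oracle programs *)

Section Programs.
Variables (R : realType) (dx dy m : nat).
Notation query := (query R dx dy m).
Notation oracle := (oracle R dx dy m).
Implicit Types (O : oracle) (P : query -> bool) (n N l : nat).

(** [algorithm] returns a point of the [y]-space only; the free monad with arbitrary result type
    lets solvers be sequenced and nested, and is converted once at the end. *)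
Inductive prog (T : Type) : Type :=
| Done of T
| Step (q : query) of (answer q -> prog T).

Fixpoint bind T U (p : prog T) (f : T -> prog U) : prog U :=
  match p with
  | Done x => f x
  | Step q next => Step (fun a => bind (next a) f)
  end.

Fixpoint run O T (p : prog T) : T :=
  match p with
  | Done x => x
  | Step q next => run O (next (O q))
  end.

Fixpoint cost P O T (p : prog T) : nat :=
  match p with
  | Done _ => 0
  | Step q next => P q + cost P O (next (O q))
  end.

Fixpoint algorithm_of (p : prog 'rV[R]_dy) : algorithm R dx dy m :=
  match p with
  | Done y => Return dx m y
  | Step q next => Ask (fun a => algorithm_of (next a))
  end.

Lemma output_algorithm_of O p : output O (algorithm_of p) = run O p.
Proof. by elim: p => //= q next IH; rewrite IH. Qed.

Lemma calls_algorithm_of P O p : calls P O (algorithm_of p) = cost P O p.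
Proof. by elim: p => //= q next IH; rewrite IH. Qed.

Lemma run_bind O T U (p : prog T) (f : T -> prog U) : run O (bind p f) = run O (f (run O p)).
Proof. by elim: p => //= q next IH; rewrite IH. Qed.

Lemma cost_bind P O T U (p : prog T) (f : T -> prog U) :
  cost P O (bind p f) = (cost P O p + cost P O (f (run O p)))%N.
Proof. by elim: p => //= q next IH; rewrite IH addnA. Qed.

(** Quantifying over all oracles makes the counts independent of the functions. One bound [cG]
    serves both partial gradients, which [ask_G] always requests together. *)
Definition bounded T (cf ch cG : nat) (p : prog T) : Prop :=
  forall O, [/\ (cost (@is_f R dx dy m) O p <= cf)%N, (cost (@is_h R dx dy m) O p <= ch)%N,
    (cost (@is_Gx R dx dy m) O p <= cG)%N & (cost (@is_Gy R dx dy m) O p <= cG)%N].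

Lemma bounded_done T (x : T) : bounded 0 0 0 (Done x).
Proof. by move=> O. Qed.

Lemma bounded_bind T U (p : prog T) (f : T -> prog U) cf ch cG cf' ch' cG' :
  bounded cf ch cG p -> (forall x, bounded cf' ch' cG' (f x)) ->
  bounded (cf + cf') (ch + ch') (cG + cG') (bind p f).
Proof.
move=> hp hf O; have [a b c d] := hp O; have [a' b' c' d'] := hf (run O p) O.
by rewrite !cost_bind; split; apply: leq_add.
Qed.

Lemma bounded_map T U (p : prog T) (f : T -> U) cf ch cG :
  bounded cf ch cG p -> bounded cf ch cG (bind p (fun x => Done (f x))).
Proof.
move=> hp; rewrite -(addn0 cf) -(addn0 ch) -(addn0 cG).
by apply: bounded_bind => // x; exact: bounded_done.
Qed.

Fixpoint repeat T n (body : T -> prog T) (s : T) : prog T :=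
  if n is j.+1 then bind (repeat j body s) body else Done s.

Lemma run_repeat O T n (body : T -> prog T) s :
  run O (repeat n body s) = iter n (fun s => run O (body s)) s.
Proof. by elim: n => //= n IH; rewrite run_bind IH. Qed.

Lemma bounded_repeat T n (body : T -> prog T) s cf ch cG :
  (forall s, bounded cf ch cG (body s)) -> bounded (n * cf) (n * ch) (n * cG) (repeat n body s).
Proof.
move=> h; elim: n => [|n IH]; first exact: bounded_done.
by rewrite !mulSn ![(_ + n * _)%N]addnC; exact: bounded_bind.
Qed.

Fixpoint sum_over (V : nmodType) T (s : seq T) (p : T -> prog V) : prog V :=
  if s is i :: s' then bind (p i) (fun a => bind (sum_over s' p) (fun b => Done (a + b)))
  else Done 0.

Lemma run_sum_over O (V : nmodType) T (s : seq T) (p : T -> prog V) :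
  run O (sum_over s p) = \sum_(i <- s) run O (p i).
Proof. by elim: s => [|i s IH] /=; rewrite ?big_nil // big_cons !run_bind IH. Qed.

Definition ask_f (x : 'rV[R]_dx) : prog 'rV[R]_dx :=
  Step (q := Query_f dy m x) (fun g => Done g).

Definition ask_h (y : 'rV[R]_dy) : prog 'rV[R]_dy :=
  Step (q := Query_h dx m y) (fun g => Done g).

Definition ask_G (w : 'rV[R]_(dx + dy)) : prog 'rV[R]_(dx + dy) :=
  bind (sum_over (enum 'I_m) (fun i =>
    Step (q := Query_Gx i (lsubmx w) (rsubmx w)) (fun g => Done (g : 'rV[R]_dx))))
  (fun a => bind (sum_over (enum 'I_m) (fun i =>
    Step (q := Query_Gy i (lsubmx w) (rsubmx w)) (fun g => Done (g : 'rV[R]_dy))))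
  (fun b => Done (row_mx (m%:R^-1 *: a) (- (m%:R^-1 *: b))))).

Definition grad_of_f O x : 'rV[R]_dx := O (Query_f dy m x).
Definition grad_of_h O y : 'rV[R]_dy := O (Query_h dx m y).
Definition saddle_grad_of_G O (w : 'rV[R]_(dx + dy)) : 'rV[R]_(dx + dy) :=
  row_mx (m%:R^-1 *: \sum_(i < m) (O (Query_Gx i (lsubmx w) (rsubmx w)) : 'rV[R]_dx))
    (- (m%:R^-1 *: \sum_(i < m) (O (Query_Gy i (lsubmx w) (rsubmx w)) : 'rV[R]_dy))).

Lemma run_ask_G O w : run O (ask_G w) = saddle_grad_of_G O w.
Proof. by rewrite /ask_G !run_bind !run_sum_over /= !big_enum. Qed.

Lemma bounded_ask_f x : bounded 1 0 0 (ask_f x). Proof. by move=> O. Qed.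
Lemma bounded_ask_h y : bounded 0 1 0 (ask_h y). Proof. by move=> O. Qed.

Lemma bounded_ask_G w : bounded 0 0 m (ask_G w).
Proof.
move=> O; rewrite /ask_G !cost_bind /=.
have h P (V : nmodType) (p : 'I_m -> prog V) c : (forall i, cost P O (p i) = c) ->
    cost P O (sum_over (enum 'I_m) p) = (m * c)%N.
  move=> pc; rewrite -[in RHS](size_enum_ord m).
  by elim: (enum 'I_m) => //= i s IH; rewrite !cost_bind pc IH /= addn0 mulSn.
split; [rewrite (h _ _ _ 0%N) // (h _ _ _ 0%N) //|rewrite (h _ _ _ 0%N) // (h _ _ _ 0%N) //
  |rewrite (h _ _ _ 1%N) // (h _ _ _ 0%N) //|rewrite (h _ _ _ 0%N) // (h _ _ _ 1%N) //];
  by rewrite !(muln0, muln1, addn0).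
Qed.

Definition accelerate_prog n1 n2 (sol : 'rV[R]_n2 -> prog 'rV[R]_(n1 + n2)) al N y0 :=
  bind (repeat N (fun s => bind (sol (extrapolate al s))
      (fun w => Done (momentum al s (rsubmx w)))) (y0, y0))
    (fun s => sol (extrapolate al s)).

Lemma run_accelerate O n1 n2 (sol : 'rV[R]_n2 -> prog 'rV[R]_(n1 + n2)) al N y0 :
  run O (accelerate_prog sol al N y0) = accelerate (fun z => run O (sol z)) al N y0.
Proof.
rewrite /accelerate_prog run_bind run_repeat /accelerate; congr (run O (sol (extrapolate al _))).
by apply: eq_iter => s; rewrite run_bind.
Qed.

Lemma bounded_accelerate n1 n2 (sol : 'rV[R]_n2 -> prog 'rV[R]_(n1 + n2)) al N y0 cf ch cG :
  (forall z, bounded cf ch cG (sol z)) ->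
  bounded (N.+1 * cf) (N.+1 * ch) (N.+1 * cG) (accelerate_prog sol al N y0).
Proof.
move=> h; rewrite !mulSn ![(_ + N * _)%N]addnC; apply: bounded_bind => //.
by apply: bounded_repeat => s; exact: bounded_map.
Qed.

End Programs.

(** * The method *)

Section Method.
Variables (R : realType) (dx dy m : nat).
Variables (mux muy Lf Lh LG : R) (x0 : 'rV[R]_dx) (y0 : 'rV[R]_dy).
Notation prog := (prog R dx dy m).
Implicit Types l : nat.

Let w0 := row_mx x0 y0.

Definition accelerate_y_prog (sol : 'rV[R]_dy -> prog 'rV[R]_(dx + dy)) mu H l :=
  accelerate_prog sol (momentum_rate mu H) (6 * l * half_life mu H) y0.

Definition accelerate_x_prog (sol : 'rV[R]_dx -> prog 'rV[R]_(dx + dy)) mu H l :=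
  bind (accelerate_prog (fun z => bind (sol z) (fun w => Done R dx dy m (swap w)))
    (momentum_rate mu H) (6 * l * half_life mu H) x0) (fun v => Done R dx dy m (swap v)).

Definition prox_prog n (ask : 'rV[R]_n -> prog 'rV[R]_n) a M ctr v0 l : prog 'rV[R]_n :=
  accelerate_prog (n1 := 0) (fun z => repeat (6 * (7 * l))
      (fun w => bind (ask w) (fun g => Done R dx dy m (prox_step a (M + a) ctr z w g))) v0)
    (momentum_rate a (M + a)) (6 * l * half_life a (M + a)) v0.

(** The minimizer of [a / 2 |p - c|^2 + b / 2 |p - u|^2]. Merging the quadratics of successive
    levels leaves every subproblem with a single one. *)
Definition center n a b (c u : 'rV[R]_n) : 'rV[R]_n := (a + b)^-1 *: (a *: c + b *: u).

(* With [A = grad G] and backward steps on [f] and [h]; in [fb_f_prog], [A = grad f]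
   and the backward steps involve [G] and [h]. *)
Definition fb_G_prog (rx : 'rV[R]_dx -> prog 'rV[R]_dx) (ry : 'rV[R]_dy -> prog 'rV[R]_dy) l :=
  repeat (6 * l) (fun w => bind (ask_G m w) (fun g => let u := w - LG^-1 *: g in
    bind (rx (lsubmx u)) (fun p => bind (ry (rsubmx u)) (fun q =>
      Done R dx dy m (row_mx p q))))) w0.

Definition fb_f_prog (sol : 'rV[R]_dx -> 'rV[R]_dy -> prog 'rV[R]_(dx + dy)) zx zy l :=
  repeat (6 * l) (fun w => bind (ask_f dy m (lsubmx w)) (fun g =>
    sol (center Lf Lf zx (lsubmx w - Lf^-1 *: g)) (center LG Lf zy (rsubmx w)))) w0.

(** In [LG + LG] one summand is the regularization of the enclosing acceleration and the other the
    backward step. The accuracy [2 * l] is what [forward_backward] demands. *)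
Definition well_conditioned_prog zx zy l :=
  fb_G_prog
    (fun u => prox_prog (ask_f dy m) (LG + LG) Lf (center LG LG zx u) x0 (2 * l))
    (fun u => prox_prog (ask_h dx m) (LG + LG) Lh (center LG LG zy u) y0 (2 * l)) l.

(** The weights record the levels passed. In [x]: [Lf] from the acceleration, [Lf] from the backward
    step against [f], [LG] from the second acceleration, [LG] from the backward step against [G];
    [f] itself is gone, so this step is explicit. In [y]: [LG], [Lf] and [LG] from the acceleration
    and the two backward steps. *)
Definition quadratic_f_inner_prog cx cy z l :=
  fb_G_prog
    (fun u => Done R dx dy m (center (Lf + Lf + LG) LG (center (Lf + Lf) LG cx z) u))
    (fun u => prox_prog (ask_h dx m) (LG + Lf + LG) Lh (center (LG + Lf) LG cy u) y0 (2 * l)) l.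

Definition quadratic_f_prog l cx cy :=
  accelerate_x_prog (fun z => quadratic_f_inner_prog cx cy z (7 * l)) Lf LG l.

Definition large_Lf_prog zy l :=
  accelerate_x_prog (fun zx => well_conditioned_prog zx zy (7 * l)) mux LG l.

Definition small_Lf_prog zy l :=
  accelerate_x_prog
    (fun zx => fb_f_prog (quadratic_f_prog (2 * (7 * l))) zx zy (7 * l)) mux Lf l.

Definition saddle_prog l :=
  accelerate_y_prog (fun zy => if LG <= Lf then large_Lf_prog zy (7 * l)
                               else small_Lf_prog zy (7 * l)) muy LG l.

(** * Correctness of the nested solvers *)

Section Correctness.
Variables (O : oracle R dx dy m) (c : R).
Variables (F : 'rV[R]_dx -> R) (H : 'rV[R]_dy -> R) (G : 'rV[R]_dx -> 'rV[R]_dy -> R).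
Let gf := grad_of_f O.
Let gh := grad_of_h O.
Let gG := saddle_grad_of_G O.
Hypotheses (hF : sc_grad mux Lf F gf) (hH : sc_grad muy Lh H gh) (hG : saddle_op 0 0 LG G gG).
Hypotheses (c0 : 0 < c) (cx : c <= mux) (cy : c <= muy).
Hypotheses (muxG : mux <= LG) (muxf : mux <= Lf) (muyG : muy <= LG) (Lh0 : 0 <= Lh).

(** The factor 4 leaves room for the quadratics added on the way down, such as [Lh + (3 * LG + Lf)]
    in a proximal step on [h]. *)
Definition accurate l : Prop := 16 <= (2 : R) ^+ l /\ 4 * (Lf + Lh + LG) <= 2 ^+ l * c.

Lemma accurateM j l : accurate l -> accurate (j.+1 * l).
Proof.
move=> [h1 h2]; have h : (2 : R) ^+ l <= 2 ^+ (j.+1 * l).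
  by apply: ler_weXn2l; [lra | rewrite mulSn leq_addr].
split; first exact: le_trans h.
by apply: le_trans h2 _; rewrite ler_wpM2r // ltW.
Qed.

Let facts : [/\ 0 < c, 0 < LG, 0 < Lf, 0 <= Lh & c <= LG /\ c <= Lf].
Proof.
have [[a1 a2] a3] := (c0, cx, cy); have [[b1 b2] b3] := (muxG, muxf, Lh0).
by split; [lra | lra | lra | lra | split; lra].
Qed.

Definition composite_op phi psi w := gG w + separable phi psi w.

Lemma saddle_op_composite mu1 mu2 L1 L2 F' H' phi psi : 0 <= L1 -> 0 <= L2 ->
  sc_grad mu1 L1 F' phi -> sc_grad mu2 L2 H' psi ->
  saddle_op mu1 mu2 (LG + (L1 + L2)) (fun x y => G x y + (F' x - H' y)) (composite_op phi psi).
Proof.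
move=> L10 L20 hf hh; have := saddle_opD hG (saddle_op_separable L10 L20 hf hh).
by rewrite !add0r.
Qed.

Lemma composite_op_addx phi psi a z :
  (fun w => composite_op phi psi w + row_mx (a *: (lsubmx w - z)) 0)
  =1 composite_op (fun x => phi x + a *: (x - z)) psi.
Proof. by move=> w; rewrite /composite_op /separable -addrA add_row_mx addr0. Qed.

Lemma composite_op_addy phi psi a (z : 'rV[R]_dy) :
  (fun w => composite_op phi psi w + row_mx 0 (a *: (rsubmx w - z)))
  =1 composite_op phi (fun y => psi y + a *: (y - z)).
Proof. by move=> w; rewrite /composite_op /separable -addrA add_row_mx addr0. Qed.

Lemma prox_prog_solves n (F' : 'rV[R]_n -> R) mu M a (ask : 'rV[R]_n -> prog 'rV[R]_n) ctr v0 l :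
  0 <= mu -> sc_grad mu M F' (fun p => run O (ask p)) -> 0 <= M -> 0 < a ->
  16 <= (2 : R) ^+ l -> M + a <= 2 ^+ l * a ->
  solves (2 ^+ l) v0 (fun p => run O (ask p) + a *: (p - ctr))
    (run O (prox_prog ask a M ctr v0 l)).
Proof.
move=> mu0 /(sc_gradW mu0 (lexx M)) [Fc gl] M0 a0 k16 Ma.
have Fc' x x' : F' x + dot (run O (ask x)) (x' - x) <= F' x'.
  by have := Fc x x'; rewrite mul0r mul0r addr0.
suff -> : run O (prox_prog ask a M ctr v0 l) = accelerate (n1 := 0)
    (fun z => iter (6 * (7 * l)) (fun w => prox_step a (M + a) ctr z w (run O (ask w))) v0)
    (momentum_rate a (M + a)) (6 * l * half_life a (M + a)) v0.
  exact: prox_solves Fc' gl M0 a0 k16 Ma.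
have := @run_accelerate R dx dy m O 0 n (fun z => repeat (6 * (7 * l))
  (fun w => bind (ask w) (fun g => Done R dx dy m (prox_step a (M + a) ctr z w g))) v0)
  (momentum_rate a (M + a)) (6 * l * half_life a (M + a)) v0.
rewrite /prox_prog => ->; congr (accelerate (n1 := 0) _ _ _ _); apply/funext => z.
by rewrite run_repeat; apply: eq_iter => w; rewrite run_bind.
Qed.

Lemma prox_f_solves l ctr : accurate l ->
  solves (2 ^+ l) x0 (fun p => gf p + (LG + LG) *: (p - ctr))
    (run O (prox_prog (ask_f dy m) (LG + LG) Lf ctr x0 l)).
Proof.
have [a1 a2 a3 a4 [a5 a6]] := facts; have mx := cx => -[k16 kL].
apply: (@prox_prog_solves _ F mux Lf _ (ask_f dy m)) => //; try lra.
have k0 : 0 <= (2 : R) ^+ l by lra.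
have := ler_wpM2l k0 a5; lra.
Qed.

Lemma prox_h_solves l a ctr : accurate l -> LG <= a <= 3 * LG + Lf ->
  solves (2 ^+ l) y0 (fun p => gh p + a *: (p - ctr))
    (run O (prox_prog (ask_h dx m) a Lh ctr y0 l)).
Proof.
have [a1 a2 a3 a4 [a5 a6]] := facts; have my := cy => -[k16 kL] /andP[al ar].
apply: (@prox_prog_solves _ H muy Lh _ (ask_h dx m)) => //; try lra.
have k0 : 0 <= (2 : R) ^+ l by lra.
have := ler_wpM2l k0 (le_trans a5 al); lra.
Qed.

Lemma run_fb_G (rx : 'rV[R]_dx -> prog 'rV[R]_dx) (ry : 'rV[R]_dy -> prog 'rV[R]_dy) l :
  run O (fb_G_prog rx ry l) = iter (6 * l) (fun w => let u := w - LG^-1 *: gG w in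
    row_mx (run O (rx (lsubmx u))) (run O (ry (rsubmx u)))) w0.
Proof.
by rewrite run_repeat; apply: eq_iter => w; rewrite run_bind run_ask_G !run_bind.
Qed.

Lemma well_conditioned_solves zx zy l : accurate l ->
  solves (2 ^+ l) w0 (composite_op (fun x => gf x + LG *: (x - zx)) (fun y => gh y + LG *: (y - zy)))
    (run O (well_conditioned_prog zx zy l)).
Proof.
have [a1 a2 a3 a4 [a5 a6]] := facts; have [mx my] := (cx, cy) => gl; have [k16 kL] := gl.
have mxG : LG <= mux + LG by lra.
have myG : LG <= muy + LG by lra.
have hx := sc_gradW mxG (lexx _) (sc_gradD hF (sc_grad_quad zx (ltW a2))).
have hy := sc_gradW myG (lexx _) (sc_gradD hH (sc_grad_quad zy (ltW a2))).
have p1 : 0 <= Lf + LG by lra.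
have p2 : 0 <= Lh + LG by lra.
pose rx u := run O (prox_prog (ask_f dy m) (LG + LG) Lf (center LG LG zx u) x0 (2 * l)).
pose ry u := run O (prox_prog (ask_h dx m) (LG + LG) Lh (center LG LG zy u) y0 (2 * l)).
rewrite run_fb_G.
apply: (forward_backward_separable (rx := rx) (ry := ry) a2 hG hx hy p1 p2 k16) => u.
- rewrite row_mxKl; apply: solves_ext (prox_f_solves (accurateM 1 gl)) => p; rewrite /center.
  by rewrite -merge_quadratics ?addrA // addr_gt0.
- rewrite row_mxKr; apply: solves_ext (prox_h_solves (accurateM 1 gl) _) => [p|].
    by rewrite /center -merge_quadratics ?addrA // addr_gt0.
  by apply/andP; split; lra.
Qed.

Lemma accelerate_x_solves (sol : 'rV[R]_dx -> prog 'rV[R]_(dx + dy)) mu1 mu2 L1 L2 F' H' phi psi h l :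
  sc_grad mu1 L1 F' phi -> sc_grad mu2 L2 H' psi -> 0 <= L1 -> 0 <= L2 ->
  c <= mu1 -> c <= mu2 -> mu1 <= h -> h <= 2 ^+ l * c -> LG + (L1 + L2) <= 2 ^+ l * c ->
  16 <= (2 : R) ^+ l ->
  (forall z, solves (2 ^+ (7 * l)) w0 (composite_op (fun x => phi x + h *: (x - z)) psi) (run O (sol z))) ->
  solves (2 ^+ l) w0 (composite_op phi psi) (run O (accelerate_x_prog sol mu1 h l)).
Proof.
move=> hf hh L10 L20 c1 c2 muh hk Lk k16 solP.
have SS := saddle_op_composite L10 L20 hf hh.
have := acceleration_x (w0 := w0) (sol := fun z => run O (sol z)) SS c0 c1 c2 Lk hk muh k16.
rewrite /accelerate_x_prog run_bind run_accelerate row_mxKl /=.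
have -> : (fun z => run O (bind (sol z) (fun w => Done R dx dy m (swap w)))) =
    (fun z => swap (run O (sol z))) by apply/funext => z; rewrite run_bind.
by apply => z; apply: solves_ext (solP z) => w; rewrite -composite_op_addx.
Qed.

Lemma large_Lf_solves zy l : accurate l ->
  solves (2 ^+ l) w0 (composite_op gf (fun y => gh y + LG *: (y - zy))) (run O (large_Lf_prog zy l)).
Proof.
have [a1 a2 a3 a4 [a5 a6]] := facts; have [mx my] := (cx, cy) => gl; have [k16 kL] := gl.
have hy := sc_gradD hH (sc_grad_quad zy (ltW a2)).
apply: (accelerate_x_solves hF hy) => //; try lra.
move=> z; exact/well_conditioned_solves/accurateM.
Qed.

Lemma quadratic_f_inner_solves zx zy z l : accurate l -> Lf <= LG ->
  solves (2 ^+ l) w0 (composite_op (fun x => (Lf + Lf) *: (x - zx) + LG *: (x - z))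
    (fun y => gh y + (LG + Lf) *: (y - zy)))
    (run O (quadratic_f_inner_prog zx zy z l)).
Proof.
have [a1 a2 a3 a4 [a5 a6]] := facts; have [mx my] := (cx, cy) => gl LfG; have [k16 kL] := gl.
have f2 : 0 <= Lf + Lf by lra.
have gf' : 0 <= LG + Lf by lra.
have mxG : LG <= Lf + Lf + LG by lra.
have myG : LG <= muy + (LG + Lf) by lra.
have hx := sc_gradW mxG (lexx _) (sc_gradD (sc_grad_quad zx f2) (sc_grad_quad z (ltW a2))).
have hy := sc_gradW myG (lexx _) (sc_gradD hH (sc_grad_quad zy gf')).
have p1 : 0 <= Lf + Lf + LG by lra.
have p2 : 0 <= Lh + (LG + Lf) by lra.
pose rx u := center (Lf + Lf + LG) LG (center (Lf + Lf) LG zx z) u.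
pose ry u := run O (prox_prog (ask_h dx m) (LG + Lf + LG) Lh (center (LG + Lf) LG zy u) y0 (2 * l)).
rewrite run_fb_G.
apply: (forward_backward_separable (rx := rx) (ry := ry) a2 hG hx hy p1 p2 k16) => u.
- apply: (@solves_exact _ _ _ LG) => //.
  + by apply: smonoW (smonoD (sc_grad_smono hx) (sc_grad_smono (sc_grad_quad u (ltW a2)))); lra.
  + rewrite /= merge_quadratics; last lra.
    rewrite merge_quadratics; last lra.
    by rewrite subrr scaler0.
- rewrite row_mxKr; apply: solves_ext (prox_h_solves (accurateM 1 gl) _) => [p|].
    rewrite /center -merge_quadratics ?addrA //; lra.
  by apply/andP; split; lra.
Qed.

Lemma quadratic_f_solves zx zy l : accurate l -> Lf <= LG ->
  solves (2 ^+ l) w0 (composite_op (fun x => (Lf + Lf) *: (x - zx)) (fun y => gh y + (LG + Lf) *: (y - zy)))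
    (run O (quadratic_f_prog l zx zy)).
Proof.
have [a1 a2 a3 a4 [a5 a6]] := facts; have [mx my] := (cx, cy) => gl LfG; have [k16 kL] := gl.
have f2 : 0 <= Lf + Lf by lra.
have gf' : 0 <= LG + Lf by lra.
have mxf : Lf <= Lf + Lf by lra.
have hx := sc_gradW mxf (lexx _) (sc_grad_quad zx f2).
have hy := sc_gradD hH (sc_grad_quad zy gf').
apply: (accelerate_x_solves hx hy) => //; try lra.
by move=> z; apply: quadratic_f_inner_solves => //; exact: accurateM.
Qed.

(** The forward operator is [(grad f, 0)], so an iteration asks for one gradient of [f]. The
    backward operator must be [Lf]-strongly monotone in both blocks; in [y] its modulus is at least
    [LG], whence the condition [Lf <= LG]. *)
Lemma fb_f_solves zx zy l : accurate l -> Lf <= LG ->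
  solves (2 ^+ l) w0 (composite_op (fun x => gf x + Lf *: (x - zx)) (fun y => gh y + LG *: (y - zy)))
    (run O (fb_f_prog (quadratic_f_prog (2 * l)) zx zy l)).
Proof.
have [a1 a2 a3 a4 [a5 a6]] := facts; have [mx my] := (cx, cy) => gl LfG; have [k16 kL] := gl.
pose A := separable gf (fun _ : 'rV[R]_dy => 0).
pose B := composite_op (fun x => Lf *: (x - zx)) (fun y => gh y + LG *: (y - zy)).
have hz : sc_grad 0 0 (fun _ : 'rV[R]_dy => 0) (fun _ : 'rV[R]_dy => 0).
  by split=> [x x'|x x']; rewrite ?dot0l ?subrr ?enorm0 !mul0r ?addr0.
have hA := saddle_op_separable (ltW a3) (lexx 0) hF hz.
have Am : smono 0 A by apply: saddle_smono hA => //; lra.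
have Al : lip Lf A by have [_ _] := hA; rewrite addr0.
have hx := sc_grad_quad zx (ltW a3).
have hy := sc_gradD hH (sc_grad_quad zy (ltW a2)).
have Lhg : 0 <= Lh + LG by lra.
have hB := saddle_op_composite (ltW a3) Lhg hx hy.
have Bm : smono Lf B by apply: saddle_smono hB; lra.
have [_ _ Bl] := hB.
have -> : run O (fb_f_prog (quadratic_f_prog (2 * l)) zx zy l) =
    iter (6 * l) (fun w => run O (quadratic_f_prog (2 * l)
      (center Lf Lf zx (lsubmx w - Lf^-1 *: gf (lsubmx w))) (center LG Lf zy (rsubmx w)))) w0.
  by rewrite run_repeat; apply: eq_iter => w; rewrite run_bind.
apply: (@solves_ext _ _ _ _ (fun w => A w + B w)) => [w|].
  rewrite /A /B /composite_op /separable addrCA add_row_mx add0r; congr (_ + row_mx _ _).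
apply: (forward_backward a3 Am Al Bm Bl k16) => w.
apply: solves_ext (quadratic_f_solves (accurateM 1 gl) LfG) => p.
rewrite /A /B /composite_op /separable /center -!merge_quadratics ?addr_gt0 // [RHS]addrCA.
move: (gG p) => g; rewrite -[p - w]hsubmxK scale_row_mx !raddfB /= !add_row_mx addr0.
congr (_ + row_mx _ _).
  by apply/rowP => j; rewrite !mxE; field; rewrite gt_eqF.
by apply/rowP => j; rewrite !mxE; ring.
Qed.

Lemma small_Lf_solves zy l : accurate l -> Lf <= LG ->
  solves (2 ^+ l) w0 (composite_op gf (fun y => gh y + LG *: (y - zy))) (run O (small_Lf_prog zy l)).
Proof.
have [a1 a2 a3 a4 [a5 a6]] := facts; have [mx my] := (cx, cy) => gl LfG; have [k16 kL] := gl.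
have hy := sc_gradD hH (sc_grad_quad zy (ltW a2)).
apply: (accelerate_x_solves hF hy) => //; try lra.
by move=> z; apply: fb_f_solves => //; exact: accurateM.
Qed.

Theorem saddle_prog_solves l : accurate l -> solves (2 ^+ l) w0 (composite_op gf gh) (run O (saddle_prog l)).
Proof.
have [a1 a2 a3 a4 [a5 a6]] := facts; have [mx my] := (cx, cy) => gl; have [k16 kL] := gl.
have SS := saddle_op_composite (ltW a3) a4 hF hH.
rewrite run_accelerate -(row_mxKr x0 y0).
apply: (acceleration SS c0) => //; try lra.
move=> zy; apply: (@solves_ext _ _ _ _ (composite_op gf (fun y => gh y + LG *: (y - zy)))) => [w|].
  by rewrite -composite_op_addy.
case: ifP => LfG; first exact/large_Lf_solves/accurateM.
by apply: small_Lf_solves; [exact: accurateM | rewrite ltW // ltNge LfG].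
Qed.

End Correctness.
End Method.

(** * Counting oracle calls *)

Section CallCounts.
Variables (R : realType) (dx dy m : nat).
Variables (mux muy Lf Lh LG : R) (x0 : 'rV[R]_dx) (y0 : 'rV[R]_dy).
Notation prog := (prog R dx dy m).
Implicit Types (l : nat).

(** The successor accounts for the final solve in [accelerate]. *)
Definition outer_calls (mu H : R) l := (6 * l * half_life mu H).+1.
Definition prox_calls (a M : R) l := (outer_calls a (M + a) l * (6 * (7 * l)))%N.

Lemma bounded_prox n (ask : 'rV[R]_n -> prog 'rV[R]_n) a M ctr v0 l cf ch cG :
  (forall x, bounded cf ch cG (ask x)) ->
  bounded (prox_calls a M l * cf) (prox_calls a M l * ch) (prox_calls a M l * cG)
    (prox_prog ask a M ctr v0 l).
Proof.
move=> h; rewrite /prox_calls -!mulnA; apply: bounded_accelerate => z; rewrite !mulnA.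
by apply: bounded_repeat => w; exact: bounded_map.
Qed.

Lemma bounded_fb_G rx ry l cf ch cf' ch' :
  (forall u, bounded cf ch 0 (rx u)) -> (forall u, bounded cf' ch' 0 (ry u)) ->
  bounded (6 * l * (cf + cf')) (6 * l * (ch + ch')) (6 * l * m)
    (@fb_G_prog R dx dy m LG x0 y0 rx ry l).
Proof.
move=> hx hy; apply: bounded_repeat => w.
rewrite -[(cf + cf')%N]add0n -[(ch + ch')%N]add0n -[X in bounded _ _ X _]addn0.
apply: bounded_bind => [|g]; first exact: bounded_ask_G.
rewrite -[X in bounded _ _ X _](addn0 0); apply: bounded_bind => // p.
exact: bounded_map.
Qed.

Lemma bounded_accelerate_x sol mu H l cf ch cG :
  (forall z, bounded cf ch cG (sol z)) ->
  bounded (outer_calls mu H l * cf) (outer_calls mu H l * ch) (outer_calls mu H l * cG)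
    (@accelerate_x_prog R dx dy m x0 sol mu H l).
Proof. by move=> h; apply: bounded_map; apply: bounded_accelerate => z; exact: bounded_map. Qed.

Lemma bounded_large_Lf zy l :
  let l' := (7 * l)%N in let N := (outer_calls mux LG l * (6 * l'))%N in
  bounded (N * prox_calls (LG + LG) Lf (2 * l')) (N * prox_calls (LG + LG) Lh (2 * l')) (N * m)
    (@large_Lf_prog R dx dy m mux Lf Lh LG x0 y0 zy l).
Proof.
move=> l' N; rewrite /N -!(mulnA (outer_calls _ _ _)); apply: bounded_accelerate_x => z.
rewrite -[X in bounded (_ * X) _ _]addn0 -[X in bounded _ (_ * X) _]add0n.
apply: bounded_fb_G => u.
  have := bounded_prox (LG + LG) Lf (center LG LG z u) x0 (2 * l') (@bounded_ask_f R dx dy m).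
  by rewrite muln1 !muln0.
have := bounded_prox (LG + LG) Lh (center LG LG zy u) y0 (2 * l') (@bounded_ask_h R dx dy m).
by rewrite muln1 !muln0.
Qed.

Lemma bounded_small_Lf zy l :
  let l1 := (7 * l)%N in let l2 := (2 * l1)%N in let l3 := (7 * l2)%N in
  let N := (outer_calls mux Lf l * (6 * l1))%N in
  let N' := (N * (outer_calls Lf LG l2 * (6 * l3)))%N in
  bounded N (N' * prox_calls (LG + Lf + LG) Lh (2 * l3)) (N' * m)
    (@small_Lf_prog R dx dy m mux Lf Lh LG x0 y0 zy l).
Proof.
move=> l1 l2 l3 N N'; rewrite /N' /N -!(mulnA (outer_calls mux Lf l)); apply: bounded_accelerate_x => z.
rewrite -!(mulnA (6 * l1)) -!(mulnA (outer_calls Lf LG l2)) -[X in bounded X]muln1.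
apply: bounded_repeat => w.
apply: (bounded_bind (cf := 1) (ch := 0) (cG := 0) (cf' := 0)
  (ch' := (outer_calls Lf LG l2 * (6 * l3 * prox_calls (LG + Lf + LG) Lh (2 * l3)))%N)
  (cG' := (outer_calls Lf LG l2 * (6 * l3 * m))%N)) => [|g]; first exact: bounded_ask_f.
rewrite -[X in bounded X _ _](muln0 (outer_calls Lf LG l2)).
apply: bounded_accelerate_x => z'; rewrite -[X in bounded X _ _](muln0 (6 * l3)).
rewrite -[X in bounded (_ * X)]addn0 -[X in bounded _ (_ * X)]add0n.
apply: bounded_fb_G => u; first exact: bounded_done.
set ctr := center _ _ _ _.
have := bounded_prox (LG + Lf + LG) Lh ctr y0 (2 * l3) (@bounded_ask_h R dx dy m).
by rewrite muln1 !muln0.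
Qed.

End CallCounts.

(** * Bounding the counts by square roots *)

Section CallBounds.
Variable R : realType.
Implicit Types (l : nat) (b s t mu H a M : R).

Lemma sqrt_ratio_ge1 mu H : 0 < mu -> mu <= H -> 1 <= Num.sqrt (H / mu).
Proof. by move=> mu0 muH; rewrite -{1}sqrtr1 ler_wsqrtr // ler_pdivlMr // mul1r. Qed.

Lemma outer_calls_le mu H l b : 0 < mu -> mu <= H -> (0 < l)%N -> 21 * l%:R <= b ->
  (outer_calls mu H l)%:R <= b * Num.sqrt (H / mu).
Proof.
move=> mu0 muH l0 lb; have s1 := sqrt_ratio_ge1 mu0 muH.
have l1 : 1 <= l%:R :> R by rewrite ler1n.
have h := half_life_le mu0 muH.
rewrite /outer_calls -natr1 !natrM.
have h2 : 6 * l%:R * (half_life mu H)%:R <= 6 * l%:R * (3 * Num.sqrt (H / mu)).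
  by rewrite ler_wpM2l.
have s0 : 0 <= Num.sqrt (H / mu) by lra.
have := ler_wpM2r s0 lb; have := ler_pM ler01 ler01 l1 s1; lra.
Qed.

Lemma prox_calls_le a M l b : 0 < a -> 0 <= M -> (0 < l)%N -> 42 * l%:R <= b ->
  (prox_calls a M l)%:R <= b ^+ 2 * Num.sqrt ((M + a) / a).
Proof.
move=> a0 M0 l0 lb; rewrite /prox_calls natrM.
have l1 : 1 <= l%:R :> R by rewrite ler1n.
have aM : a <= M + a by rewrite lerDr.
have h1 : (outer_calls a (M + a) l)%:R <= b * Num.sqrt ((M + a) / a).
  by apply: outer_calls_le => //; lra.
have h2 : (6 * (7 * l))%:R <= b by rewrite !natrM; lra.
by apply: le_trans (ler_pM (ler0n _ _) (ler0n _ _) h1 h2) _; rewrite expr2 mulrAC.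
Qed.

(** A proximal step takes a gradient even if [M] is far below [LG]; this is the origin of the
    maximum in the bound for [h]. *)
Lemma sqrt_prox_le_max a M LG : 0 < LG -> LG <= a -> 0 <= M ->
  Num.sqrt ((M + a) / a) <= 2 * Num.max (Num.sqrt (M / LG)) 1.
Proof.
move=> LG0 La M0; have a0 := lt_le_trans LG0 La.
have E : (M + a) / a = M / a + 1 by field; rewrite gt_eqF.
have h : M / a <= M / LG by rewrite ler_wpM2l // lef_pV2.
have q0 : 0 <= M / LG by rewrite divr_ge0 // ltW.
set s := Num.sqrt (M / LG).
have sE : s ^+ 2 = M / LG by rewrite sqr_sqrtr.
have s0 : 0 <= s by exact: sqrtr_ge0.
set t := Num.max s 1.
have t0 : 0 <= t by rewrite le_max s0.
have h1 : s ^+ 2 <= t ^+ 2 by rewrite ler_sqr ?nnegrE // le_max lexx.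
have h2 : 1 ^+ 2 <= t ^+ 2 by rewrite ler_sqr ?nnegrE // le_max lexx orbT.
rewrite expr1n in h2.
rewrite -ler_sqr ?nnegrE ?sqrtr_ge0 ?mulr_ge0 // sqr_sqrtr; last first.
  by rewrite E addr_ge0 // divr_ge0 // ltW.
rewrite E exprMn; lra.
Qed.

Lemma sqrt_prox_le a M LG : 0 < LG -> LG <= a -> LG <= M ->
  Num.sqrt ((M + a) / a) <= 2 * Num.sqrt (M / LG).
Proof.
move=> LG0 La LM; have M0 : 0 <= M by rewrite ltW // (lt_le_trans LG0).
have := sqrt_prox_le_max LG0 La M0.
by rewrite max_l // sqrt_ratio_ge1.
Qed.

Lemma ler_pow_pM b i j s t (x y : nat) : 0 <= s ->
  x%:R <= b ^+ i * s -> y%:R <= b ^+ j * t -> (x * y)%:R <= b ^+ (i + j) * (s * t).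
Proof.
move=> s0 hx hy; rewrite natrM exprD.
by apply: le_trans (ler_pM (ler0n _ _) (ler0n _ _) hx hy) _; rewrite mulrACA.
Qed.

Lemma ler_pM_double (a s x y : R) : 0 <= a * s -> x <= 2 * y -> a * (s * 1 * x) <= 2 * (a * s * y).
Proof. by move=> as0 /(ler_wpM2l as0); lra. Qed.

End CallBounds.

Section SaddleCalls.
Variables (R : realType) (dx dy m : nat).
Variables (mux muy Lf Lh LG : R) (x0 : 'rV[R]_dx) (y0 : 'rV[R]_dy) (l : nat).
Hypotheses (mux0 : 0 < mux) (muy0 : 0 < muy) (muxG : mux <= LG) (muxf : mux <= Lf).
Hypotheses (muyG : muy <= LG) (Lh0 : 0 <= Lh) (l0 : (0 < l)%N).
Variable b : R.
Hypothesis lb : 40 * (40 * (40 * l%:R)) <= b.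

Lemma saddle_prog_calls : exists cf ch cG : nat,
  [/\ bounded cf ch cG (@saddle_prog R dx dy m mux muy Lf Lh LG x0 y0 l),
    cf%:R <= 2 * b ^+ 7 * Num.sqrt (LG * Lf / (mux * muy)),
    ch%:R <= 2 * b ^+ 7 * Num.max (Num.sqrt (LG * Lh / (mux * muy)))
                                  (Num.sqrt (LG ^+ 2 / (mux * muy)))
  & cG%:R <= 2 * b ^+ 7 * (m%:R * Num.sqrt (LG ^+ 2 / (mux * muy)))].
Proof.
have G0 := lt_le_trans mux0 muxG; have f0 := lt_le_trans mux0 muxf.
have [mx my] := (mux0, muy0).
have gx := muxG; have gy := muyG; have fx := muxf; have h0 := Lh0.
have l1 : 1 <= l%:R :> R by rewrite ler1n.
have bb := lb; have b1 : 1 <= b by lra.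
(* The deepest accuracy is [7 * 7 * 2 * 7 * 2 = 1372] times [l], and [prox_calls_le] needs 42 times
   that, that is [21 * 2744 * l]; [40 ^+ 3] exceeds [21 * 2744]. *)
have bl j : (j <= 2744)%N -> 21 * (j * l)%:R <= b.
  rewrite natrM -(ler_nat R) => jl; have := ler_wpM2r (ler0n R l) jl; lra.
clear bb; have b0 : 0 <= b by lra.
have nn (u v : R) : 0 < u -> 0 < v -> 0 <= u / v by move=> u0 v0; rewrite divr_ge0 ?ltW.
have sG : Num.sqrt (LG / muy) * Num.sqrt (LG / mux) = Num.sqrt (LG ^+ 2 / (mux * muy)).
  by rewrite -(sqrtrM _ (nn _ _ G0 my)); congr Num.sqrt; field; rewrite !gt_eqF.
have sf : Num.sqrt (LG / muy) * Num.sqrt (Lf / mux) = Num.sqrt (LG * Lf / (mux * muy)).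
  by rewrite -(sqrtrM _ (nn _ _ G0 my)); congr Num.sqrt; field; rewrite !gt_eqF.
(* The intermediate regularization cancels: [LG] here, for [LG <= Lf], and [Lf] in [sfG], for the
   other case. *)
have sGf : Num.sqrt (LG / mux) * Num.sqrt (Lf / LG) = Num.sqrt (Lf / mux).
  by rewrite -(sqrtrM _ (nn _ _ G0 mx)); congr Num.sqrt; field; rewrite !gt_eqF.
have sfG : Num.sqrt (Lf / mux) * Num.sqrt (LG / Lf) = Num.sqrt (LG / mux).
  by rewrite -(sqrtrM _ (nn _ _ f0 mx)); congr Num.sqrt; field; rewrite !gt_eqF.
have G2 : 0 <= LG ^+ 2 / (mux * muy) by rewrite divr_ge0 ?sqr_ge0 // mulr_ge0 ?ltW.
have sh : Num.sqrt (LG ^+ 2 / (mux * muy)) * Num.max (Num.sqrt (Lh / LG)) 1 =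
    Num.max (Num.sqrt (LG * Lh / (mux * muy))) (Num.sqrt (LG ^+ 2 / (mux * muy))).
  rewrite maxr_pMr ?sqrtr_ge0 // mulr1 -(sqrtrM _ G2).
  by congr Num.max; congr Num.sqrt; field; rewrite !gt_eqF.
have NY : (outer_calls muy LG l)%:R <= b ^+ 1 * Num.sqrt (LG / muy).
  by rewrite expr1; apply: outer_calls_le => //; have := bl 1%N isT; rewrite mul1n.
have fbl j : (j <= 2744)%N -> (6 * (j * l))%:R <= b ^+ 1 * 1.
  by move=> /bl; rewrite expr1 mulr1 natrM; have := ler0n R (j * l); lra.
have s0 : 0 <= Num.sqrt (LG / muy) * Num.sqrt (LG / mux) by rewrite mulr_ge0 ?sqrtr_ge0.
have Xf := sqrtr_ge0 (LG * Lf / (mux * muy)).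
have Xh : 0 <= Num.max (Num.sqrt (LG * Lh / (mux * muy))) (Num.sqrt (LG ^+ 2 / (mux * muy))).
  by rewrite le_max sqrtr_ge0.
have XG := mulr_ge0 (ler0n R m) (sqrtr_ge0 (LG ^+ 2 / (mux * muy))).
have fin i s X (x : nat) : (i <= 7)%N -> 0 <= X -> s <= 2 * X -> x%:R <= b ^+ i * s -> x%:R <= 2 * b ^+ 7 * X.
  move=> i7 X0 sX /le_trans; apply; have bi : 0 <= b ^+ i by exact: exprn_ge0.
  apply: le_trans (ler_wpM2l bi sX) _; rewrite [X in _ <= X]mulrAC [X in _ <= X]mulrC.
  by apply: ler_wpM2r; [exact: mulr_ge0 | exact: ler_weXn2l].
have [LGf|LfG] := leP LG Lf.
- pose l' := (7 * (7 * l))%N.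
  pose N := (outer_calls mux LG (7 * l) * (6 * l'))%N.
  exists (outer_calls muy LG l * (N * prox_calls (LG + LG) Lf (2 * l')))%N.
  exists (outer_calls muy LG l * (N * prox_calls (LG + LG) Lh (2 * l')))%N.
  exists (outer_calls muy LG l * (N * m))%N.
  have NN : N%:R <= b ^+ 2 * (Num.sqrt (LG / mux) * 1).
    apply: (@ler_pow_pM R b 1 1); first exact: sqrtr_ge0.
      by rewrite expr1; apply: outer_calls_le; rewrite ?bl ?muln_gt0.
    by rewrite /l' (mulnA 7 7) fbl.
  have P2 M : 0 <= M ->
      (prox_calls (LG + LG) M (2 * l'))%:R <= b ^+ 2 * Num.sqrt ((M + (LG + LG)) / (LG + LG)).
    move=> M0; apply: prox_calls_le; rewrite ?addr_gt0 ?muln_gt0 //.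
    rewrite /l' !mulnA; have := bl (2 * (2 * 7 * 7))%N isT.
    by rewrite -[(2 * _ * l)%N]mulnA natrM; lra.
  have GG : LG <= LG + LG by rewrite lerDl ltW.
  split.
  + apply: bounded_accelerate => zy; rewrite LGf; exact: bounded_large_Lf.
  + apply: fin (ler_pow_pM (sqrtr_ge0 _) NY (ler_pow_pM _ NN (P2 _ (ltW f0)))) => //.
    rewrite -sf -sGf [X in 2 * X]mulrA.
    exact: ler_pM_double s0 (sqrt_prox_le G0 GG LGf).
  + apply: fin (ler_pow_pM (sqrtr_ge0 _) NY (ler_pow_pM _ NN (P2 _ h0))) => //.
    rewrite -sh -sG; exact: ler_pM_double s0 (sqrt_prox_le_max G0 GG h0).
  + have mm : m%:R <= b ^+ 0 * m%:R by rewrite expr0 mul1r.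
    apply: fin (ler_pow_pM (sqrtr_ge0 _) NY (ler_pow_pM _ NN mm)) => //.
    by rewrite mulr1 mulrA sG mulrC ler_peMl // ler1n.
- pose l1' := (7 * (7 * l))%N; pose l2 := (2 * l1')%N; pose l3 := (7 * l2)%N.
  pose N := (outer_calls mux Lf (7 * l) * (6 * l1'))%N.
  pose N' := (N * (outer_calls Lf LG l2 * (6 * l3)))%N.
  exists (outer_calls muy LG l * N)%N.
  exists (outer_calls muy LG l * (N' * prox_calls (LG + Lf + LG) Lh (2 * l3)))%N.
  exists (outer_calls muy LG l * (N' * m))%N.
  have fG := ltW LfG.
  have NN : N%:R <= b ^+ 2 * (Num.sqrt (Lf / mux) * 1).
    apply: (@ler_pow_pM R b 1 1); first exact: sqrtr_ge0.
      by rewrite expr1; apply: outer_calls_le; rewrite ?bl ?muln_gt0.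
    by rewrite /l1' (mulnA 7 7) fbl.
  have NN' : N'%:R <= b ^+ 4 * (Num.sqrt (LG / mux) * 1).
    have -> : Num.sqrt (LG / mux) * 1 =
      Num.sqrt (Lf / mux) * 1 * (Num.sqrt (LG / Lf) * 1) by rewrite !mulr1.
    apply: (@ler_pow_pM R b 2 2) NN _; first by rewrite mulr1 sqrtr_ge0.
    apply: (@ler_pow_pM R b 1 1); first exact: sqrtr_ge0.
      by rewrite expr1; apply: outer_calls_le; rewrite ?muln_gt0 // /l2 /l1' !mulnA bl.
    have -> : l3 = (7 * 2 * 7 * 7 * l)%N by rewrite /l3 /l2 /l1' !mulnA.
    exact: fbl.
  have GG : LG <= LG + Lf + LG by rewrite lerDr addr_ge0 ?ltW.
  have P2 : (prox_calls (LG + Lf + LG) Lh (2 * l3))%:R <=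
      b ^+ 2 * Num.sqrt ((Lh + (LG + Lf + LG)) / (LG + Lf + LG)).
    apply: prox_calls_le; rewrite ?addr_gt0 ?muln_gt0 //.
    have := bl (2 * 2 * 7 * 2 * 7 * 7)%N isT; rewrite -!mulnA -/l1' -/l2 -/l3.
    by rewrite natrM; lra.
  split.
  + apply: bounded_accelerate => zy; rewrite leNgt LfG; exact: bounded_small_Lf.
  + apply: fin (ler_pow_pM (sqrtr_ge0 _) NY NN) => //.
    by rewrite mulr1 sf ler_peMl ?sqrtr_ge0 // ler1n.
  + apply: fin (ler_pow_pM (sqrtr_ge0 _) NY (ler_pow_pM _ NN' P2)) => //.
    rewrite -sh -sG; exact: ler_pM_double s0 (sqrt_prox_le_max G0 GG h0).
  + have mm : m%:R <= b ^+ 0 * m%:R by rewrite expr0 mul1r.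
    apply: fin (ler_pow_pM (sqrtr_ge0 _) NY (ler_pow_pM _ NN' mm)) => //.
    by rewrite mulr1 mulrA sG mulrC ler_peMl // ler1n.
Qed.

End SaddleCalls.
(** * Gradients of convex functions *)

Section Gradients.
Variable R : realType.

Lemma convex_strongly_convex0 n (f : 'rV[R]_n -> R) : convex f -> strongly_convex 0 f.
Proof.
move=> cf x y t /andP[t0 t1]; rewrite !mul0r subr0.
exact: (cf (Itv01 t0 t1) x y (mem_set I) (mem_set I)).
Qed.

(** Divide the convexity inequality by [t] and let [t] decrease to 0. A free direction [v] covers
    full gradients and, with one block zero, partial ones. *)
Lemma segment_derive_le (V : normedModType R) (g : V -> R) z v (a : R) :
  derivable g z v ->
  (forall t, 0 <= t <= 1 -> g (t *: v + z) <= t * g (v + z) + (1 - t) * g z - t * (1 - t) * a) ->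
  g z + 'D_v g z + a <= g (v + z).
Proof.
move=> dg h.
have q : (h^-1 *: ((g \o shift z) (h *: v) - g z) @[h --> (0:R)^'+] --> 'D_v g z)%classic.
  by apply: cvg_dnbhs_at_right; exact: dg.
have q2 : (g (v + z) - g z - (1 - t) * a @[t --> (0:R)^'+] --> g (v + z) - g z - (1 - 0) * a)%classic.
  apply: cvgB; first exact: cvg_cst.
  apply: cvgMr_tmp; apply: cvgB; first exact: cvg_cst.
  exact: cvg_at_right_filter.
have := ler_cvg_to q q2.
suff near : (\forall t \near (0:R)^'+, t^-1 *: ((g \o shift z) (t *: v) - g z) <=
   g (v + z) - g z - (1 - t) * a)%classic.
  by move/(_ _ near); lra.
near=> t.
have t0 : 0 < t by near: t; exact: nbhs_right_gt.
have t1 : t <= 1 by near: t; apply: nbhs_right_le.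
rewrite /= -[_ *: _]/(_ * _) mulrC ler_pdivrMr //.
have t01 : 0 <= t <= 1 by rewrite ltW.
have := h t t01; lra.
Unshelve. all: by end_near. Qed.

Lemma derive_dot n (f : 'rV[R]_n -> R) x v : differentiable f x -> 'D_v f x = dot (grad f x) v.
Proof.
move=> df; rewrite deriveE // {1}(row_sum_delta v) linear_sum; apply: eq_bigr => j _.
by rewrite linearZ -deriveE // mxE mulrC.
Qed.

Lemma gradient_inequality n mu (f : 'rV[R]_n -> R) x x' :
  strongly_convex mu f -> differentiable f x ->
  f x + dot (grad f x) (x' - x) + mu / 2 * nsq (x' - x) <= f x'.
Proof.
move=> cf df; have := @segment_derive_le _ f x (x' - x) (mu / 2 * nsq (x' - x)).
rewrite subrK -derive_dot //; apply; first exact: diff_derivable.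
move=> t t01; have -> : t *: (x' - x) + x = t *: x' + (1 - t) *: x.
  by apply/rowP => j; rewrite !mxE; ring.
by have := cf x' x t t01; rewrite enorm_sqr; lra.
Qed.

Lemma smooth_sc_grad n mu L (f : 'rV[R]_n -> R) :
  strongly_convex mu f -> smooth L f -> sc_grad mu L f (grad f).
Proof. by move=> cf [_ df lf]; split=> // x x'; exact: gradient_inequality. Qed.

Lemma derive_congr (V W : normedModType R) (f : V -> R) (g : W -> R) a b u v :
  (forall e : R, f (e *: u + a) = g (e *: v + b)) -> 'D_u f a = 'D_v g b.
Proof.
move=> h; rewrite /derive; have h0 : f a = g b by have := h 0; rewrite !scale0r !add0r.
suff -> : (fun e : R => e^-1 *: ((f \o shift a) (e *: u) - f a)) =
  (fun e => e^-1 *: ((g \o shift b) (e *: v) - g b)) by [].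
by apply/funext => e /=; rewrite h h0.
Qed.

Section Partial.
Variables (dx dy : nat) (g : 'rV[R]_dx -> 'rV[R]_dy -> R).
Let joint (z : 'rV[R]_(dx + dy)) := g (lsubmx z) (rsubmx z).

(** The oracle differentiates one block at a time, whereas smoothness concerns the joint function;
    the difference quotients agree along lines on which the other block is constant. *)
Lemma grad_partial_l x y : grad (fun x' => g x' y) x = lsubmx (grad joint (row_mx x y)).
Proof.
apply/rowP => j; rewrite !mxE; apply: derive_congr => e.
rewrite /joint !raddfD /= !linearZ /= row_mxKl row_mxKr; congr (g (_ *: _ + _) _).
  by apply/rowP => i; rewrite !mxE (inj_eq (@lshift_inj _ _)).
rewrite (_ : rsubmx _ = 0) ?scaler0 ?add0r //.
by apply/rowP => i; rewrite !mxE eq_rlshift andbF.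
Qed.

Lemma grad_partial_r x y : grad (fun y' => g x y') y = rsubmx (grad joint (row_mx x y)).
Proof.
apply/rowP => j; rewrite !mxE; apply: derive_congr => e.
rewrite /joint !raddfD /= !linearZ /= row_mxKl row_mxKr; congr (g _ (_ *: _ + _)).
  rewrite (_ : lsubmx _ = 0) ?scaler0 ?add0r //.
  by apply/rowP => i; rewrite !mxE eq_lrshift andbF.
by apply/rowP => i; rewrite !mxE (inj_eq (@rshift_inj _ _)).
Qed.

Lemma smooth_saddle_op L :
  (forall y, convex (fun x => g x y)) -> (forall x, concave (fun y => g x y)) -> smooth L joint ->
  saddle_op 0 0 L g (fun w => row_mx (lsubmx (grad joint w)) (- rsubmx (grad joint w))).
Proof.
move=> gx gy [L0 dg lg]; split.
- move=> x x' y; rewrite row_mxKl !mul0r addr0.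
  have := @segment_derive_le _ joint (row_mx x y) (row_mx (x' - x) 0) 0.
  rewrite derive_dot // dot_submx row_mxKl row_mxKr dot0r addr0.
  rewrite add_row_mx subrK add0r /joint !row_mxKl !row_mxKr addr0; apply.
    exact: diff_derivable.
  move=> t t01; rewrite scale_row_mx add_row_mx row_mxKl row_mxKr scaler0 add0r mulr0 subr0.
  have := convex_strongly_convex0 (gx y) x' x t01; rewrite !mul0r subr0.
  suff -> : t *: (x' - x) + x = t *: x' + (1 - t) *: x by [].
  by apply/rowP => j; rewrite !mxE; ring.
- move=> x y y'; rewrite row_mxKr !mul0r subr0.
  have := @segment_derive_le _ (- joint) (row_mx x y) (row_mx 0 (y' - y)) 0.
  rewrite deriveN; last exact: diff_derivable.
  rewrite derive_dot // dot_submx row_mxKl row_mxKr dot0r add0r.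
  rewrite add_row_mx subrK add0r /joint /= !fctE !row_mxKl !row_mxKr addr0 dotNl => h.
  suff : - g x y - dot (rsubmx (grad joint (row_mx x y))) (y' - y) <= - g x y' by lra.
  apply: h; first by apply: derivableN; exact: diff_derivable.
  move=> t t01; rewrite scale_row_mx add_row_mx row_mxKl row_mxKr scaler0 add0r mulr0 subr0.
  have := convex_strongly_convex0 (gy x) y' y t01; rewrite !mul0r subr0.
  suff -> : t *: (y' - y) + y = t *: y' + (1 - t) *: y by [].
  by apply/rowP => j; rewrite !mxE; ring.
- move=> u v; apply: le_trans (lg u v).
  rewrite opp_row_mx add_row_mx !enormE nsq_row -opprD nsqN -!raddfB.
  by rewrite -nsq_submx.
Qed.

End Partial.

Lemma saddle_op_average dx dy m (L : 'I_m -> R) (K : 'I_m -> 'rV[R]_dx -> 'rV[R]_dy -> R) T :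
  (forall i, saddle_op 0 0 (L i) (K i) (T i)) ->
  saddle_op 0 0 (average L) (fun x y => average (fun i => K i x y))
    (fun w => m%:R^-1 *: \sum_(i < m) T i w).
Proof.
move=> h; have mi : 0 <= m%:R^-1 :> R by rewrite invr_ge0.
have sumdot n (s : 'I_m -> 'rV[R]_n) v : dot (\sum_i s i) v = \sum_i dot (s i) v.
  by elim/big_rec2: _ => [|i a b _ <-]; rewrite ?dot0l ?dotDl.
split.
- move=> x x' y; rewrite linearZ /= dotZl !mul0r addr0 -mulrDr; apply: ler_wpM2l => //.
  rewrite [lsubmx _]linear_sum sumdot -big_split; apply: ler_sum => i _.
  by have [Kx _ _] := h i; have := Kx x x' y; rewrite !mul0r addr0.
- move=> x y y'; rewrite linearZ /= dotZl !mul0r subr0 -mulrBr; apply: ler_wpM2l => //.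
  rewrite [rsubmx _]linear_sum sumdot -sumrB; apply: ler_sum => i _.
  by have [_ Ky _] := h i; have := Ky x y y'; rewrite !mul0r subr0.
- move=> u v; rewrite -scalerBr -sumrB enormZ ger0_norm // /average -mulrA.
  apply: ler_wpM2l => //; apply: le_trans (enorm_sum _) _.
  by rewrite mulr_suml; apply: ler_sum => i _; have [_ _] := h i; exact.
Qed.

Lemma oracle_saddle_op dx dy m (L : 'I_m -> R) f h (Gi : 'I_m -> 'rV[R]_dx -> 'rV[R]_dy -> R) :
  (forall i y, convex (fun x => Gi i x y)) -> (forall i x, concave (fun y => Gi i x y)) ->
  (forall i, smooth (L i) (fun z : 'rV[R]_(dx + dy) => Gi i (lsubmx z) (rsubmx z))) ->
  saddle_op 0 0 (average L) (fun x y => average (fun i => Gi i x y))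
    (saddle_grad_of_G (first_order_oracle f h Gi)).
Proof.
move=> gx gy gs; apply: saddle_op_ext (saddle_op_average _) => [w|i]; last first.
  exact: smooth_saddle_op (gx i) (gy i) (gs i).
rewrite /saddle_grad_of_G -[LHS]hsubmxK; congr row_mx.
  rewrite linearZ linear_sum; congr (_ *: _); apply: eq_bigr => i _.
  by apply: (etrans (row_mxKl _ _)); rewrite /= grad_partial_l hsubmxK.
rewrite linearZ linear_sum -scalerN -sumrN; congr (_ *: _); apply: eq_bigr => i _.
by apply: (etrans (row_mxKr _ _)); rewrite /= grad_partial_r hsubmxK.
Qed.

End Gradients.

(** * Precision and conclusion *)

Section Precision.
Variable R : realType.
Implicit Types (c L eps r Q : R).

(** Each summand is a lower bound required of [k = 2 ^+ l]; the last one yields accuracy [eps],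
    since [r / c ^+ 2] bounds the squared initial distance. The successor makes the power of two
    exceed the sum. *)
Definition precision c L eps r : nat :=
  (trunc_log 2 (Num.truncn (16 + 4 * (L / c) + L ^+ 2 * r / (c ^+ 3 * eps)))).+1.

Lemma precisionP c L eps r : 0 < c -> 0 <= L -> 0 < eps -> 0 <= r ->
  let k : R := 2 ^+ precision c L eps r in
  [/\ 16 <= k, 4 * L <= k * c & (2 * c)^-1 * (L ^+ 2 * (k^-1 ^+ 2 * (r / c ^+ 2))) <= eps].
Proof.
move=> c0 L0 e0 r0 k.
set S := 16 + 4 * (L / c) + L ^+ 2 * r / (c ^+ 3 * eps).
have Sk : S <= k.
  apply/ltW/(lt_le_trans (Num.Theory.truncnS_gt S)).
  rewrite /k -natrX ler_nat /precision -/S.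
  by rewrite trunc_log_ltn.
have a1 : 0 <= L / c by rewrite divr_ge0 // ltW.
have ce : 0 < c ^+ 3 * eps by rewrite mulr_gt0 // exprn_gt0.
have a2 : 0 <= L ^+ 2 * r / (c ^+ 3 * eps) by rewrite divr_ge0 ?mulr_ge0 ?sqr_ge0 // ltW.
have k16 : 16 <= k by rewrite (le_trans _ Sk) // /S; lra.
split=> //.
  rewrite -ler_pdivrMr //; apply: le_trans Sk; rewrite /S; lra.
have k0 : 0 < k by lra.
have h : L ^+ 2 * r <= k * (c ^+ 3 * eps).
  by rewrite -ler_pdivrMr //; apply: le_trans Sk; rewrite /S; lra.
have h2 : L ^+ 2 * r <= 2 * k ^+ 2 * c ^+ 3 * eps.
  apply: le_trans h _; rewrite -mulrA; apply: ler_wpM2r; first exact: ltW.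
  have : k * 1 <= k * k by rewrite ler_pM2l //; lra.
  by rewrite expr2; lra.
have -> : (2 * c)^-1 * (L ^+ 2 * (k^-1 ^+ 2 * (r / c ^+ 2))) =
    L ^+ 2 * r / (2 * k ^+ 2 * c ^+ 3) by field; rewrite !gt_eqF.
by rewrite ler_pdivrMr ?mulr_gt0 ?exprn_gt0 // [X in _ <= X]mulrC.
Qed.

(** With [P = 2 + Q] the last summand is at most [P ^+ (2 + 4 + 3) * E], and [P ^+ 2 >= 4] absorbs
    the addition of the others: exponent 11. The successor costs one more [ln P], and turning
    [12 * ln P + ln E] into a multiple of the product gives 13. *)
Lemma precision_le c L eps r Q : 0 < c -> 0 <= L -> 0 < eps -> 0 <= r ->
  0 <= Q -> L <= Q -> c^-1 <= Q -> r <= Q ^+ 4 ->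
  (precision c L eps r)%:R <= 13 / ln 2 ^+ 2 * (ln (2 + Q) * ln (2 + eps^-1)).
Proof.
move=> c0 L0 e0 r0 Q0 LQ cQ rQ.
have ei : 0 < eps^-1 by rewrite invr_gt0.
set P := 2 + Q; set E := 2 + eps^-1.
have P2 : 2 <= P by rewrite /P; lra.
have E2 : 2 <= E by rewrite /E; lra.
have d0 : 0 < ln (2 : R) by rewrite ln_gt0 ?ltr1n.
have dP : ln 2 <= ln P by rewrite ler_ln // posrE; lra.
have dE : ln 2 <= ln E by rewrite ler_ln // posrE; lra.
set S := 16 + 4 * (L / c) + L ^+ 2 * r / (c ^+ 3 * eps).
have ci : 0 < c^-1 by rewrite invr_gt0.
have LP : L <= P by rewrite /P; lra.
have cP : c^-1 <= P by rewrite /P; lra.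
have QP : Q <= P by rewrite /P; lra.
have pow j : 2 ^+ j <= P ^+ j by apply: lerXn2r; rewrite ?nnegrE //; lra.
have P9 : P ^+ 4 <= P ^+ 9 * E.
  apply: (@le_trans _ _ (P ^+ 9 * 1)).
    by rewrite mulr1; apply: ler_weXn2l => //; lra.
  by apply: ler_wpM2l; [rewrite exprn_ge0 //; lra | lra].
have SP : S <= P ^+ 11 * E.
  have s1 : 16 <= P ^+ 4 by apply: le_trans (pow 4%N); rewrite !exprS expr0; lra.
  have s2 : 4 * (L / c) <= P ^+ 4.
    have h : L / c <= P * P by apply: ler_pM => //; exact: ltW.
    have h4 : 4 <= P ^+ 2 by apply: le_trans (pow 2%N); rewrite !exprS expr0; lra.
    have lc : 0 <= L / c by rewrite divr_ge0 // ltW.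
    have := ler_pM (ler0n R 4) lc h4 h; by rewrite -expr2 -exprD.
  have s3 : L ^+ 2 * r / (c ^+ 3 * eps) <= P ^+ 9 * E.
    have -> : L ^+ 2 * r / (c ^+ 3 * eps) = L ^+ 2 * r * (c^-1 ^+ 3) * eps^-1.
      by field; rewrite !gt_eqF.
    have -> : P ^+ 9 = P ^+ 2 * P ^+ 4 * P ^+ 3 by rewrite -!exprD.
    have l2 : L ^+ 2 <= P ^+ 2 by apply: lerXn2r; rewrite ?nnegrE //; lra.
    have q4 : r <= P ^+ 4 by apply: le_trans rQ _; apply: lerXn2r; rewrite ?nnegrE //; lra.
    have c3 : c^-1 ^+ 3 <= P ^+ 3 by apply: lerXn2r; rewrite ?nnegrE //; lra.
    have c30 : 0 <= c^-1 ^+ 3 by rewrite exprn_ge0 // ltW.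
    have lr := mulr_ge0 (sqr_ge0 L) r0.
    have eE : eps^-1 <= E by rewrite /E; lra.
    have h := ler_pM lr c30 (ler_pM (sqr_ge0 L) r0 l2 q4) c3.
    exact: ler_pM (mulr_ge0 lr c30) (ltW ei) h eE.
  have : 4 * (P ^+ 9 * E) <= P ^+ 2 * (P ^+ 9 * E).
    apply: ler_wpM2r; first by rewrite mulr_ge0 ?exprn_ge0 //; lra.
    by apply: le_trans (pow 2%N); rewrite !exprS expr0; lra.
  have -> : P ^+ 11 = P ^+ 2 * P ^+ 9 by rewrite -exprD.
  rewrite -mulrA /S; lra.
have S1 : 1 <= S.
  have a1 : 0 <= L / c by rewrite divr_ge0 // ltW.
  have ce : 0 < c ^+ 3 * eps by rewrite mulr_gt0 // exprn_gt0.
  have a2 : 0 <= L ^+ 2 * r / (c ^+ 3 * eps) by rewrite divr_ge0 ?mulr_ge0 ?sqr_ge0 // ltW.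
  by rewrite /S; lra.
have key : (trunc_log 2 (Num.truncn S))%:R * ln 2 <= 11 * ln P + ln E.
  have n0 : (0 < Num.truncn S)%N by rewrite Num.Theory.truncn_gt0.
  set j := trunc_log _ _.
  have jS : 2 ^+ j <= S.
    apply: (@le_trans _ _ (Num.truncn S)%:R).
      by rewrite -natrX ler_nat; exact: trunc_logP.
    by rewrite Num.Theory.truncn_le; lra.
  have : ln (2 ^+ j) <= ln (P ^+ 11 * E).
    have j0 : (0 : R) < 2 ^+ j by rewrite exprn_gt0.
    have jE := le_trans jS SP.
    by rewrite ler_ln // posrE //; exact: lt_le_trans jE.
  rewrite lnM ?posrE ?exprn_gt0 //; try lra.
  by rewrite !lnXn //; try lra; rewrite -!mulr_natl.
rewrite /precision -/S -natr1; move: (_%:R) key => t key.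
have i0 : 0 < (ln (2 : R) ^+ 2)^-1 by rewrite invr_gt0 exprn_gt0.
have h1 : ln P * ln 2 <= ln P * ln E by rewrite ler_wpM2l //; lra.
have h2 : ln 2 * ln E <= ln P * ln E by rewrite ler_wpM2r //; lra.
rewrite [X in _ <= X]mulrAC ler_pdivlMr ?exprn_gt0 //.
have : (t + 1) * ln 2 * ln 2 <= (12 * ln P + ln E) * ln 2.
  by rewrite ler_pM2r //; lra.
rewrite expr2; lra.
Qed.

End Precision.

Section FullMethod.
Variables (R : realType) (dx dy m : nat) (mux muy Lf Lh LG eps : R).
Variables (x0 : 'rV[R]_dx) (y0 : 'rV[R]_dy).

(* The distance to the saddle point is unknown; the norm of the saddle operator at
   the starting point bounds it and fixes the number of iterations. *)
Definition full_prog : prog R dx dy m 'rV[R]_dy :=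
  bind (ask_f dy m x0) (fun gx => bind (ask_h dx m y0) (fun gy =>
  bind (ask_G m (row_mx x0 y0)) (fun gw =>
  bind (saddle_prog m mux muy Lf Lh LG x0 y0
    (precision (Num.min mux muy) (LG + (Lf + Lh)) eps (nsq (gw + row_mx gx gy))))
    (fun w => Done R dx dy m (rsubmx w))))).

End FullMethod.

Section Conclusion.
Variable R : realType.

Lemma zero_saddle_point dx dy mux muy L f h G (T : 'rV[R]_(dx + dy) -> 'rV[R]_(dx + dy)) ws :
  0 <= mux -> 0 <= muy -> saddle_op mux muy L (fun x y => G x y + (f x - h y)) T -> T ws = 0 ->
  is_saddle_point f h G (lsubmx ws) (rsubmx ws).
Proof.
move=> m1 m2 [Kx Ky _] wsE x y.
have := Kx (lsubmx ws) x (rsubmx ws); have := Ky (lsubmx ws) (rsubmx ws) y.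
rewrite hsubmxK wsE !raddf0 !dot0l.
have := mulr_ge0 m1 (nsq_ge0 (x - lsubmx ws)); have := mulr_ge0 m2 (nsq_ge0 (y - rsubmx ws)).
by move=> *; apply/andP; split; lra.
Qed.

(** The quantity in [eps_solution] is [F (rsubmx w) - F (rsubmx ws)] for the primal function [F], so
    [primal_gap] applies; the zero [ws] supplies the minimizer of [F]. *)
Lemma eps_solution_of_gap dx dy mux muy L c f h G
    (T : 'rV[R]_(dx + dy) -> 'rV[R]_(dx + dy)) ws w eps :
  0 < c -> c <= mux -> c <= muy -> saddle_op mux muy L (fun x y => G x y + (f x - h y)) T ->
  T ws = 0 -> (2 * c)^-1 * nsq (T w) <= eps -> eps_solution f h G eps (rsubmx w).
Proof.
move=> c0 c1 c2 KT wsE gap; have m1 := lt_le_trans c0 c1; have m2 := lt_le_trans c0 c2.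
have [F FP] := saddle_primal m1 KT.
have g := primal_gap KT c0 c1 c2 FP w (rsubmx ws).
have Fmax y : is_max [set h y - G x y - f x | x in [set: 'rV[R]_dx]]%classic (F y).
  have [ub [x Fx]] := FP y; split; first by exists x => //; rewrite Fx; ring.
  by move=> _ [x' _ <-]; have := ub x'; lra.
exists (F (rsubmx w) - h (rsubmx w)), (F (rsubmx ws)); split; last lra.
- have [[x _ xE] ub] := Fmax (rsubmx w); split.
    by exists x => //; rewrite -xE; ring.
  by move=> _ [x' _ <-]; have /ub := imageT (fun x => h (rsubmx w) - G x (rsubmx w) - f x) x'; lra.
- split; first by exists (rsubmx ws); exact: Fmax.
  move=> u [y [_ ub]]; have [im _] := Fmax y; apply: le_trans (ub _ im).
  have := primal_subgradient KT c0 c1 FP ws y; rewrite wsE !raddf0 nsq0 mulr0 dot0l subr0 addr0.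
  have := mulr_ge0 (ltW m2) (nsq_ge0 (y - rsubmx ws)); lra.
Qed.

(** [n0] stands for the calls made before [l] is known; [n0 <= X] turns the constant 2 into 3. *)
Lemma soft_O_of_precision (c1 Q eps X : R) (l n n0 : nat) :
  0 <= X -> (0 < l)%N -> l%:R <= c1 * (ln (2 + Q) * ln (2 + eps^-1)) ->
  n0%:R <= X -> n%:R <= 2 * (40 * (40 * (40 * l%:R))) ^+ 7 * X ->
  soft_O (3 * (40 * (40 * (40 * c1))) ^+ 7) 7 Q eps X (n0 + n).
Proof.
move=> X0 l0 lc n0X nX; rewrite /soft_O natrD.
set b := 40 * (40 * (40 * l%:R)) in nX.
have l1 : 1 <= l%:R :> R by rewrite ler1n.
have b7 : 1 <= b ^+ 7 by rewrite exprn_ege1 // /b; lra.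
have bX := ler_wpM2r X0 b7.
apply: (@le_trans _ _ (3 * b ^+ 7 * X)); first lra.
apply: ler_wpM2r => //; set a := 40 * (40 * (40 * c1)); move: lc.
set p := ln (2 + Q); set e := ln (2 + eps^-1) => lc.
have ba : b <= a * (p * e) by rewrite /a /b; lra.
have -> : 3 * a ^+ 7 * p ^+ 7 * e ^+ 7 = 3 * (a * (p * e)) ^+ 7 by rewrite !exprMn; ring.
have b0 : 0 <= b by rewrite /b; lra.
by apply: ler_wpM2l => //; apply: lerXn2r; rewrite ?nnegrE // (le_trans b0).
Qed.

End Conclusion.

Theorem theorem7 (R : realType) :
  exists (C : R) (k : nat), 0 < C /\
  forall (dx dy m : nat) (mux muy Lf Lh : R) (LGi : 'I_m -> R),
    let LG := average LGi in
    (0 < m)%N -> 0 < mux -> 0 < muy ->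
    mux <= LG -> mux <= Lf -> muy <= LG ->
  forall (x0 : 'rV[R]_dx) (y0 : 'rV[R]_dy) (eps : R), 0 < eps ->
  exists A : algorithm R dx dy m,
  forall (f : 'rV[R]_dx -> R) (h : 'rV[R]_dy -> R)
         (Gi : 'I_m -> 'rV[R]_dx -> 'rV[R]_dy -> R),
    strongly_convex mux f -> smooth Lf f ->
    strongly_convex muy h -> smooth Lh h ->
    (forall i y, convex (fun x => Gi i x y)) ->
    (forall i x, concave (fun y => Gi i x y)) ->
    (forall i, smooth (LGi i)
       (fun z : 'rV[R]_(dx + dy) => Gi i (lsubmx z) (rsubmx z))) ->
    let G := fun x y => average (fun i => Gi i x y) in
    let O := first_order_oracle f h Gi in
    eps_solution f h G eps (output O A) /\
    exists (xs : 'rV[R]_dx) (ys : 'rV[R]_dy),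
      is_saddle_point f h G xs ys /\
      let D := enorm (row_mx x0 y0 - row_mx xs ys) in
      let Q := Lf + Lh + LG + mux^-1 + muy^-1 + D in
      [/\ soft_O C k Q eps (Num.sqrt (LG * Lf / (mux * muy)))
            (calls (@is_f R dx dy m) O A),
          soft_O C k Q eps
            (Num.max (Num.sqrt (LG * Lh / (mux * muy)))
                     (Num.sqrt (LG ^+ 2 / (mux * muy))))
            (calls (@is_h R dx dy m) O A),
          soft_O C k Q eps (m%:R * Num.sqrt (LG ^+ 2 / (mux * muy)))
            (calls (@is_Gx R dx dy m) O A)
        & soft_O C k Q eps (m%:R * Num.sqrt (LG ^+ 2 / (mux * muy)))
            (calls (@is_Gy R dx dy m) O A)].
Proof.
have ln2 : 0 < ln (2 : R) by rewrite ln_gt0 ?ltr1n.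
have c10 : 0 < 13 / ln (2 : R) ^+ 2 by rewrite divr_gt0 // exprn_gt0.
exists (3 * (40 * (40 * (40 * (13 / ln 2 ^+ 2)))) ^+ 7), 7%N; split.
  by apply: mulr_gt0 => //; apply: exprn_gt0; do 3 apply: mulr_gt0 => //.
move=> dx dy m mux muy Lf Lh LGi LG m0 mux0 muy0 muxG muxf muyG x0 y0 eps eps0.
exists (algorithm_of (full_prog m mux muy Lf Lh LG eps x0 y0)).
move=> f h Gi fc fs hc hs Gx Gy Gs G O.
have Lh0 : 0 <= Lh by case: hs.
have LG0 := lt_le_trans mux0 muxG; have Lf0 := lt_le_trans mux0 muxf.
have hF : sc_grad mux Lf f (grad_of_f O) := smooth_sc_grad fc fs.
have hH : sc_grad muy Lh h (grad_of_h O) := smooth_sc_grad hc hs.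
have hG : saddle_op 0 0 LG G (saddle_grad_of_G O) := oracle_saddle_op f h Gx Gy Gs.
set c := Num.min mux muy.
have c0 : 0 < c by rewrite lt_min mux0.
have cx : c <= mux by rewrite ge_min lexx.
have cy : c <= muy by rewrite ge_min lexx orbT.
have KT := saddle_op_composite hG (ltW Lf0) Lh0 hF hH.
set T := composite_op O _ _ in KT; set L := LG + (Lf + Lh) in KT.
have L0 : 0 <= L by rewrite /L; lra.
have Tm := saddle_smono cx cy KT; have [_ _ Tl] := KT.
have [ws wsE] := exist_zero c0 Tm Tl.
set w0 := row_mx x0 y0; set r := nsq (T w0).
have r0 : 0 <= r := nsq_ge0 _.
have [l lE] : exists l, l = precision c L eps r by exists (precision c L eps r).
have l0 : (0 < l)%N by rewrite lE.
have := precisionP c0 L0 eps0 r0; rewrite -lE => -[k16 kL kgap].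
have gl : accurate Lf Lh LG c l.
  by split; [exact: k16 | apply: le_trans kL; rewrite /L; lra].
have d0r : nsq (w0 - ws) <= r / c ^+ 2.
  have := Tm w0 ws; rewrite wsE subr0; have ci : 0 < c^-1 by rewrite invr_gt0.
  have /andP[_] := dot_Young (T w0) (w0 - ws) ci; rewrite invrK -/r => Y S.
  rewrite ler_pdivlMr ?exprn_gt0 // expr2 mulrA -ler_pdivlMr // mulrC (mulrC r); lra.
set sp := saddle_prog m mux muy Lf Lh LG x0 y0 l.
set w := run O sp.
have wd : nsq (w - ws) <= (2 ^+ l)^-1 ^+ 2 * nsq (w0 - ws).
  have := saddle_prog_solves x0 y0 hF hH hG c0 cx cy muxG muxf muyG Lh0 gl wsE.
  by rewrite enorm_le ?mulr_ge0 ?enorm_ge0 ?invr_ge0 ?exprn_ge0 // exprMn enorm_sqr.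
have TE : saddle_grad_of_G O w0 + row_mx (grad_of_f O x0) (grad_of_h O y0) = T w0.
  by rewrite /T /composite_op /separable row_mxKl row_mxKr.
have costE P : cost P O (full_prog m mux muy Lf Lh LG eps x0 y0) =
    (cost P O (ask_f dy m x0) + cost P O (ask_h dx m y0) + cost P O (ask_G m w0) + cost P O sp)%N.
  rewrite /full_prog cost_bind cost_bind cost_bind cost_bind run_ask_G -/w0 /= TE -/r -/c -/L -lE.
  by rewrite !addn0 !addnA.
have outE : output O (algorithm_of (full_prog m mux muy Lf Lh LG eps x0 y0)) = rsubmx w.
  by rewrite output_algorithm_of /full_prog 4!run_bind run_ask_G -/w0 /= TE -/r -/c -/L -lE.
split.
  rewrite outE; apply: (eps_solution_of_gap c0 cx cy KT wsE); apply: le_trans kgap.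
  have i0 : 0 <= (2 * c)^-1 by rewrite invr_ge0 mulr_ge0 // ltW.
  apply: ler_wpM2l => //; have := lip_nsq w ws Tl; rewrite wsE subr0 => /le_trans; apply.
  apply: ler_wpM2l; first exact: sqr_ge0.
  by apply: le_trans wd _; apply: ler_wpM2l d0r; rewrite exprn_ge0 // invr_ge0 exprn_ge0.
exists (lsubmx ws), (rsubmx ws); split.
  exact: zero_saddle_point (ltW mux0) (ltW muy0) KT wsE.
rewrite hsubmxK -/w0 !calls_algorithm_of !costE => D Q.
have D0 : 0 <= D := enorm_ge0 _.
have [mi mj] : 0 < mux^-1 /\ 0 < muy^-1 by rewrite !invr_gt0.
have Q0 : 0 <= Q by rewrite /Q; lra.
have LQ : L <= Q by rewrite /L /Q; lra.
have DQ : D <= Q by rewrite /Q; lra.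
have cQ : c^-1 <= Q.
  by rewrite /c minEle; case: ifP => _; rewrite /Q; lra.
(* The method measures the residual while [Q] contains the distance: [r <= L ^+ 2 * D ^+ 2]
   translates one into the other inside the logarithm. *)
have rQ : r <= Q ^+ 4.
  have := lip_nsq w0 ws Tl; rewrite wsE subr0 -/r => /le_trans; apply.
  rewrite (exprD Q 2 2) -enorm_sqr; apply: ler_pM; rewrite ?sqr_ge0 //.
    by rewrite ler_sqr ?nnegrE.
  by rewrite ler_sqr ?nnegrE.
have lle := precision_le c0 L0 eps0 r0 Q0 LQ cQ rQ; rewrite -lE in lle.
have [cf [ch [cG [bnd fb hb Gb]]]] :=
  saddle_prog_calls m x0 y0 mux0 muy0 muxG muxf muyG Lh0 l0 (lexx _).
have [b1 b2 b3 b4] := bnd O.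
have [f1 f2 f3 f4] := bounded_ask_f x0 O; have [h1 h2 h3 h4] := bounded_ask_h y0 O.
have [g1 g2 g3 g4] := bounded_ask_G w0 O.
have nat_le (n n' : nat) a : (n <= n')%N -> n'%:R <= a -> n%:R <= a :> R.
  by move=> nn; apply: le_trans; rewrite ler_nat.
(* The targets are at least 1, so they absorb the initial queries at [(x0, y0)]. *)
have X1 : 1 <= Num.sqrt (LG ^+ 2 / (mux * muy)).
  rewrite -{1}sqrtr1 ler_wsqrtr // ler_pdivlMr ?mulr_gt0 // mul1r expr2.
  by apply: ler_pM => //; exact: ltW.
have X2 : 1 <= Num.sqrt (LG * Lf / (mux * muy)).
  rewrite -{1}sqrtr1 ler_wsqrtr // ler_pdivlMr ?mulr_gt0 // mul1r mulrC.
  by apply: ler_pM => //; exact: ltW.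
have X3 : 1 <= Num.max (Num.sqrt (LG * Lh / (mux * muy))) (Num.sqrt (LG ^+ 2 / (mux * muy))).
  by rewrite le_max X1 orbT.
have mX : m%:R <= m%:R * Num.sqrt (LG ^+ 2 / (mux * muy)) by rewrite ler_peMr.
split.
- apply: (soft_O_of_precision _ l0 lle); first lra.
    apply: (nat_le _ 1%N) X2.
    exact: leq_add (leq_add f1 h1) g1.
  exact: nat_le b1 fb.
- apply: (soft_O_of_precision _ l0 lle); first lra.
    apply: (nat_le _ 1%N) X3.
    exact: leq_add (leq_add f2 h2) g2.
  exact: nat_le b2 hb.
- apply: (soft_O_of_precision _ l0 lle); first by rewrite mulr_ge0 ?sqrtr_ge0.
    apply: (nat_le _ m) mX.
    exact: leq_add (leq_add f3 h3) g3.
  exact: nat_le b3 Gb.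
- apply: (soft_O_of_precision _ l0 lle); first by rewrite mulr_ge0 ?sqrtr_ge0.
    apply: (nat_le _ m) mX.
    exact: leq_add (leq_add f4 h4) g4.
  exact: nat_le b4 Gb.
Qed.
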